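(* Let $P=k[x,y,z]$ be a standard graded polynomial ring over a field $k$ of odd prime characteristic $p$, with $\mathfrak m=(x,y,z)$. Let $d$ be an even number with $2\le d<p+1$. Fix two powers $q_1>q_0\ge d+3$ of $p$. For a general choice of homogeneous $f\in P$ with $\deg f=d$, the graded Betti numbers in homological degrees $2$ and higher of the $R=P/(f)$-modules $R/\mathfrak m^{[q_0]}$ and $R/\mathfrak m^{[q_1]}$ are the same up to a constant shift of $\frac32(q_1-q_0)$; that is, for all $i\ge2$ and all $j$, $$\beta^R_{i,j}(R/\mathfrak m^{[q_0]})=\beta^R_{i,\,j+\frac32(q_1-q_0)}(R/\mathfrak m^{[q_1]}).$$
   Context: $\mathfrak m^{[q]}$ is the ideal generated by $x^q,y^q,z^q$. $\beta^R_{i,j}(N)=\dim_k\operatorname{Tor}^R_i(N,k)_j$ denotes the graded Betti numbers over $R$. ''For a general choice of homogeneous $f$ of degree $d$'' means: there is a nonempty Zariski open subset of the affine space $k^N$ of coefficients of homogeneous degree $d$ polynomials such that the conclusion holds for every $f$ (nonzero of degree $d$) with coefficients in it. *)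

(* Defs.v *)
From HB Require Import structures.
From mathcomp Require Import all_boot all_order all_algebra.
From mathcomp Require Import mpoly.
From Stdlib Require Import ClassicalEpsilon.

Set Implicit Arguments.
Unset Strict Implicit.
Unset Printing Implicit Defensive.

Import GRing.Theory.
Local Open Scope ring_scope.
Local Open Scope quotient_scope.

Section GradedBetti.
(* R is a graded ring: in_degree n r says that r is zero or homogeneous of degree
   n. eps is the projection of R onto its residue field k = R/R_+. *)
Variables (k : fieldType) (R : comPzRingType).
Variables (in_degree : int -> R -> Prop) (eps : R -> k).

(* F_i = \bigoplus_l R(- gdeg i l), elements of F_i are row vectors, and
   dif i : F_(i+1) -> F_i acts by v |-> v *m dif i. The entries of aug are
   lifts to R of the images of the basis of F_0 in a cyclic module R/J. *)
Record free_complex := FreeComplex {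
  rk : nat -> nat;
  gdeg : forall i, 'I_(rk i) -> int;
  dif : forall i, 'M[R]_(rk i.+1, rk i);
  aug : 'cV[R]_(rk 0)
}.

(* ... -> F_1 -> F_0 -> R/J -> 0 is exact, with maps of degree 0. *)
Record graded_resolution (J : R -> Prop) (F : free_complex) : Prop := {
  res_homog_dif : forall i a b,
    in_degree (gdeg (i := i.+1) a - gdeg (i := i) b) (dif F i a b);
  res_homog_aug : forall a, in_degree (gdeg (i := 0) a) (aug F a 0);
  res_surj : forall r : R, exists v : 'rV[R]_(rk F 0),
    J (r - (v *m aug F) 0 0);
  res_exact0 : forall v : 'rV[R]_(rk F 0),
    J ((v *m aug F) 0 0) <-> exists w, v = w *m dif F 0;
  res_exact : forall i (v : 'rV[R]_(rk F i.+1)),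
    v *m dif F i = 0 <-> exists w, v = w *m dif F i.+1
}.

Section Tor.
Variables (F : free_complex).

Definition residue_dif i : 'M[k]_(rk F i.+1, rk F i) := map_mx eps (dif F i).

Definition strand i (j : int) : 'M[k]_(rk F i) :=
  diag_mx (\row_l (gdeg l == j)%:R).

Definition cycles i : 'M[k]_(rk F i) :=
  if i is i'.+1 then kermx (residue_dif i') else 1%:M.

Definition boundaries i (j : int) : 'M[k]_(rk F i.+1, rk F i) :=
  strand i.+1 j *m residue_dif i.

(* \dim_k H_i(F \otimes_R k)_j; boundaries are cycles, so the subtraction does
   not truncate. *)
Definition homology_dim i (j : int) : nat :=
  (\rank (cycles i :&: strand i j)%MS - \rank (boundaries i j))%N.

End Tor.

(* \dim_k Tor_i^R(R/J, k)_j. It does not depend on the resolution; over a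
   noetherian graded ring a resolution by free modules of finite rank
   exists. *)
Definition graded_betti (J : R -> Prop) (i : nat) (j : int) : nat :=
  epsilon (inhabits 0%N)
    (fun b => exists2 F, graded_resolution J F & b = homology_dim F i j).

End GradedBetti.

Section Hypersurface.
Variables (k : fieldType) (f : {mpoly k[3]}).

Definition principal_ideal : {pred {mpoly k[3]}} :=
  fun g => if excluded_middle_informative (exists h, g = h * f)
           then true else false.

Lemma principal_idealP g :
  reflect (exists h, g = h * f) (g \in principal_ideal).
Proof.
rewrite unfold_in /principal_ideal.
by case: excluded_middle_informative => H; constructor.
Qed.

Fact principal_ideal_zmod_closed : zmod_closed principal_ideal.
Proof.
split=> [|g h /principal_idealP[a ->] /principal_idealP[b ->]].
  by apply/principal_idealP; exists 0; rewrite mul0r.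
by apply/principal_idealP; exists (a - b); rewrite mulrBl.
Qed.

HB.instance Definition _ :=
  GRing.isZmodClosed.Build {mpoly k[3]} principal_ideal
    principal_ideal_zmod_closed.

(* The ring structure that the library puts on {ideal_quot I} requires I to be
   proper; it is rebuilt here on the quotient group so that P/(f) is a ring for
   every f. *)
Definition hypersurface := Quotient.quot principal_ideal.

HB.instance Definition _ := EqQuotient.on hypersurface.
HB.instance Definition _ := GRing.Zmodule.on hypersurface.

Local Notation R := hypersurface.

Lemma hypersurface_eqP (g h : {mpoly k[3]}) :
  \pi_R g = \pi_R h <-> exists a, g - h = a * f.
Proof.
split=> [e|e]; last first.
  by apply/eqP; rewrite -Quotient.idealrBE; apply/principal_idealP.
by apply/principal_idealP; rewrite Quotient.idealrBE; apply/eqP.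
Qed.

Definition hyp_one : R := \pi_R 1.
Definition hyp_mul : R -> R -> R := lift_op2 R *%R.

Lemma hyp_pi_mul g h : hyp_mul (\pi_R g) (\pi_R h) = \pi_R (g * h).
Proof.
unlock hyp_mul.
have [a ea] : exists a, repr (\pi_R g) - g = a * f.
  by apply/hypersurface_eqP; rewrite reprK.
have [b eb] : exists b, repr (\pi_R h) - h = b * f.
  by apply/hypersurface_eqP; rewrite reprK.
apply/hypersurface_eqP; exists (a * repr (\pi_R h) + g * b).
have -> : repr (\pi_R g) * repr (\pi_R h) - g * h =
  (repr (\pi_R g) - g) * repr (\pi_R h) + g * (repr (\pi_R h) - h).
  by rewrite mulrBl mulrBr addrA subrK.
by rewrite ea eb mulrDl mulrA mulrAC.
Qed.

Fact hyp_mulA : associative hyp_mul.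
Proof.
by move=> x y z; rewrite -[x]reprK -[y]reprK -[z]reprK !hyp_pi_mul mulrA.
Qed.

Fact hyp_mulC : commutative hyp_mul.
Proof. by move=> x y; rewrite -[x]reprK -[y]reprK !hyp_pi_mul mulrC. Qed.

Fact hyp_mul1 : left_id hyp_one hyp_mul.
Proof. by move=> x; rewrite -[x]reprK hyp_pi_mul mul1r. Qed.

Fact hyp_mulDl : left_distributive hyp_mul +%R.
Proof.
move=> x y z; rewrite -[x]reprK -[y]reprK -[z]reprK -raddfD !hyp_pi_mul.
by rewrite mulrDl raddfD.
Qed.

HB.instance Definition _ :=
  GRing.Zmodule_isComPzRing.Build R hyp_mulA hyp_mulC hyp_mul1 hyp_mulDl.

Lemma hyp_piD (g h : {mpoly k[3]}) : \pi_R (g + h) = \pi_R g + \pi_R h.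
Proof. exact: raddfD. Qed.

Lemma hyp_piM (g h : {mpoly k[3]}) : \pi_R (g * h) = \pi_R g * \pi_R h.
Proof. by rewrite -hyp_pi_mul. Qed.

Lemma hyp_pi1 : \pi_R (1 : {mpoly k[3]}) = 1.
Proof. by []. Qed.

(* This is the grading of P/(f) when f is homogeneous. *)
Definition hyp_homog (n : int) (r : R) : Prop :=
  if n is Posz m then
    exists2 g : {mpoly k[3]}, g \is m.-homog & r = \pi_R g
  else r = 0.

Definition hyp_residue (r : R) : k := (repr r)@_0%MM.

Lemma hyp_residueE (g : {mpoly k[3]}) :
  f@_0%MM = 0 -> hyp_residue (\pi_R g) = g@_0%MM.
Proof.
move=> f0; have [a ea] : exists a, repr (\pi_R g) - g = a * f.
  by apply/hypersurface_eqP; rewrite reprK.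
apply/eqP; rewrite -subr_eq0 /hyp_residue -mcoeffB ea.
by rewrite [_@_0]rmorphM /= f0 mulr0.
Qed.

Definition frobenius_power (q : nat) (r : R) : Prop :=
  exists a : 'I_3 -> R, r = \sum_(l < 3) a l * (\pi_R 'X_l) ^+ q.

Definition betti_frobenius_power (q i : nat) (j : int) : nat :=
  graded_betti hyp_homog hyp_residue (frobenius_power q) i j.

End Hypersurface.

Section GeneralForms.
Variable k : fieldType.

Definition form_monomials (d : nat) : {set 'X_{1..3 < d.+1}} :=
  [set m : 'X_{1..3 < d.+1} | mdeg m == d].

Definition form (d : nat) (c : 'I_#|form_monomials d| -> k) : {mpoly k[3]} :=
  \sum_i c i *: 'X_[enum_val i].

Definition zariski_open (N : nat) (U : ('I_N -> k) -> Prop) : Prop :=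
  exists S : {mpoly k[N]} -> Prop,
    forall c, U c <-> exists2 g, S g & g.@[c] != 0.

(* The zero polynomial is excluded from the nonempty open set of coefficients:
   it has no degree, and over a finite field {0} is open in affine space. *)
Definition for_general_form (d : nat) (C : {mpoly k[3]} -> Prop) : Prop :=
  exists U : ('I_#|form_monomials d| -> k) -> Prop,
    [/\ zariski_open U,
        exists c, U c /\ form c != 0
      & forall c, U c -> form c != 0 -> C (form c)].

End GeneralForms.

(* Main.v *)
(* With q = 2r+1, d = 2e and N = 3r+e, let Z be the second syzygy module of
   R/m^[q] over R = P/(f), i.e. the kernel of R(-q)^3 -> R. If multiplication by f
   is bijective from degree 3r-e to degree 3r+e of the complete intersection
   P/(x^q,y^q,z^q), then Z vanishes in degrees <= N; if moreover f is monic in z,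
   then x, y is a regular sequence on Z, and Z is free over k[x,y] on 2d
   generators of degree N+1. Multiplication by z on Z is then a 2d x 2d matrix A of
   linear forms in k[x,y], so Z is the cokernel of phi = z - A over P, and
   phi psi = psi phi = f for some psi of degree d-1. The minimal R-resolution of
   R/m^[q] is therefore periodic from degree 2 on, and its Betti numbers there
   depend on q only through the shift by N.

   Both conditions on f are the nonvanishing of a polynomial in its coefficients,
   and f = (xy - z^2)^e satisfies them for all q simultaneously: graded by the
   torus fixing xy and z, the bijectivity becomes the statement that a polynomial
   (t-1)^e h(t) without middle coefficients vanishes. A suitable derivative of it
   has more zeros at 0 and 1 than its degree allows, and the condition d < p+1
   makes the derivative lose no coefficient mod p. *)

From HB Require Import structures.
Require Import Defs.
From mathcomp Require Import all_boot all_order all_algebra.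
From mathcomp Require Import mpoly zify ring.
From Stdlib Require Import ClassicalEpsilon.
Set Implicit Arguments.
Unset Strict Implicit.
Unset Printing Implicit Defensive.
Import GRing.Theory.
Local Open Scope ring_scope.

(** * Betti numbers do not depend on the resolution *)

(** A complement [C] of [B] in [Z] is carried injectively by [A] to a space that meets [B'] only in
    0, so the two fit side by side in [Z']. This bounds a homology dimension by another along a map
    injective on homology. *)
Lemma mxrank_quotient_inj (k : fieldType) (m n p q r : nat)
    (Z : 'M[k]_(p, m)) (B : 'M[k]_(q, m)) (B' : 'M[k]_(r, n))
    (Z' : 'M[k]_n) (A : 'M[k]_(m, n)) :
  (B <= Z)%MS -> (B' <= Z')%MS -> (Z *m A <= Z')%MS ->
  (forall z : 'rV_m, (z <= Z)%MS -> (z *m A <= B')%MS -> (z <= B)%MS) ->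
  (\rank Z - \rank B <= \rank Z' - \rank B')%N.
Proof.
move=> sBZ sBZ' sZA inj; set C := (Z :\: B)%MS.
have sCZ : (C <= Z)%MS by apply: diffmxSl.
have CB0 : (C :&: B)%MS = 0 by apply: capmx_diff.
have rC : (\rank C + \rank B = \rank Z)%N.
  by rewrite -(mxrank_cap_compl Z B) (capmx_idPr sBZ) addnC.
have kC : forall z : 'rV_m, (z <= C)%MS -> (z *m A <= B')%MS -> z = 0.
  move=> z zC zB; apply/eqP; rewrite -submx0 -CB0 sub_capmx zC.
  by apply: inj => //; apply: submx_trans sCZ.
have rCA : \rank (C *m A) = \rank C.
  apply/mxrank_injP; rewrite -submx0; apply/rV_subP=> z.
  rewrite sub_capmx => /andP[zC /sub_kermxP zA].
  by rewrite (kC z zC) ?sub0mx // zA sub0mx.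
have CAB : (C *m A :&: B')%MS = 0.
  apply/eqP; rewrite -submx0; apply/rV_subP=> z.
  rewrite sub_capmx => /andP[/submxP[y ->] yB].
  rewrite mulmxA in yB *.
  by rewrite (kC (y *m C)) ?mul0mx ?sub0mx ?submxMl // mulmxA.
have := mxrank_sum_cap (C *m A) B'.
rewrite CAB mxrank0 addn0 rCA => e.
have : (\rank (C *m A + B')%MS <= \rank Z')%N.
  by apply: mxrankS; rewrite addsmx_sub sBZ' andbT (submx_trans _ sZA) // submxMr.
rewrite e -rC addnK => le.
by rewrite leq_subRL ?mxrankS // addnC.
Qed.

(** * Comparison of graded resolutions up to homotopy *)

Section Comparison.
Variables (k : fieldType) (R : comPzRingType) (in_degree : int -> R -> Prop).
Variables (eps : {rmorphism R -> k}) (comp : int -> R -> R) (J : R -> Prop).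
Hypothesis compD : forall n r s, comp n (r + s) = comp n r + comp n s.
Hypothesis comp_deg : forall n r, in_degree n (comp n r).
Hypothesis comp_id : forall n r, in_degree n r -> comp n r = r.
Hypothesis compM :
  forall n m r s, in_degree m s -> comp n (r * s) = comp (n - m) r * s.
Hypothesis eps_deg : forall n r, in_degree n r -> n != 0 -> eps r = 0.
Hypothesis JD : forall r s, J r -> J s -> J (r + s).
Hypothesis JM : forall r s, J s -> J (r * s).
Hypothesis Jcomp : forall n r, J r -> J (comp n r).

Let comp0 n : comp n 0 = 0.
Proof. by apply: (addrI (comp n 0)); rewrite -compD !addr0. Qed.

Let comp_sum n (I : finType) (F : I -> R) :
  comp n (\sum_i F i) = \sum_i comp n (F i).
Proof. exact: (big_morph (comp n) (@compD n) (comp0 n)). Qed.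

Let compN n r : comp n (- r) = - comp n r.
Proof. by apply/eqP; rewrite -subr_eq0 opprK -compD addNr comp0. Qed.

Let J0 : (exists r, J r) -> J 0.
Proof. by case=> r /(JM 0); rewrite mul0r. Qed.

Let J_sum (I : finType) (F : I -> R) :
  J 0 -> (forall i, J (F i)) -> J (\sum_i F i).
Proof. by move=> J00 JF; elim/big_ind: _ => //; apply: JD. Qed.

(** With this sign convention [v |-> v *m M] has degree 0 between free modules with generators in
    degrees [g] and [g']. *)
Definition homog_mx m n (g : 'I_m -> int) (g' : 'I_n -> int) (M : 'M[R]_(m, n)) :=
  forall a b, in_degree (g a - g' b) (M a b).

(** Homogeneity is read off from [comp]: each entry equals its own component of the expected
    degree. *)
Lemma homog_mxM m n l (g : 'I_m -> int) (g' : 'I_n -> int) (g'' : 'I_l -> int)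
    (M : 'M[R]_(m, n)) (N : 'M[R]_(n, l)) :
  homog_mx g g' M -> homog_mx g' g'' N -> homog_mx g g'' (M *m N).
Proof.
move=> hM hN a b; rewrite mxE.
suff -> : \sum_j M a j * N j b = comp (g a - g'' b) (\sum_j M a j * N j b) by [].
rewrite comp_sum; apply: eq_bigr => c _; rewrite (compM _ _ (hN c b)).
by rewrite opprB addrA addrNK comp_id.
Qed.

(** Since [comp] commutes with multiplication by the homogeneous entries of [D], replacing the
    entries of any factor by their components of the right degree does not change the product. *)
Lemma homog_mx_factor m n l (g : 'I_m -> int) (g' : 'I_n -> int)
    (g'' : 'I_l -> int) (M : 'M[R]_(m, n)) (D : 'M[R]_(l, n)) :
  homog_mx g g' M -> homog_mx g'' g' D ->
  (forall a, exists w, row a M = w *m D) ->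
  exists2 W, homog_mx g g'' W & M = W *m D.
Proof.
move=> hM hD /fin_all_exists[w ew].
exists (\matrix_(a, c) comp (g a - g'' c) (w a 0 c)).
  by move=> a c; rewrite mxE.
apply/matrixP=> a b; rewrite -(comp_id (hM a b)).
have -> : M a b = (row a M) 0 b by rewrite mxE.
rewrite ew !mxE comp_sum; apply: eq_bigr => c _; rewrite mxE.
by rewrite (compM _ _ (hD c b)); congr (comp _ _ * _); rewrite opprB addrA addrNK.
Qed.

Section TwoComplexes.
Variables F K : free_complex R.

Definition cycle (F : free_complex R) i : 'rV[R]_(rk F i) -> Prop :=
  if i is i'.+1 then fun v => v *m dif F i' = 0
  else fun v => J ((v *m aug F) 0 0).

(* [chain_lift c i M]: M is the i-th term of a chain map F -> K inducing the
   map given by the column c on generators of F_0. *)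
Fixpoint chain_lift (c : 'cV[R]_(rk F 0)) i : 'M[R]_(rk F i, rk K i) -> Prop :=
  if i is i'.+1 then
    fun M => exists2 M', chain_lift c M' & dif F i' *m M' = M *m dif K i'
  else fun M => forall a, J ((c - M *m aug K) a 0).

Lemma chain_lift_cycle c i M :
  J 0 -> (forall v, @cycle F 0 v -> J ((v *m c) 0 0)) ->
  @chain_lift c i M -> forall v, cycle v -> cycle (v *m M).
Proof.
move=> J00 hc; case: i M => [|i] M /= hM v hv.
  have -> : v *m M *m aug K = v *m c - v *m (c - M *m aug K).
    by rewrite mulmxBr mulmxA subKr.
  rewrite !mxE; apply: JD; first by have := hc v hv; rewrite mxE.
  by rewrite -mulN1r; apply/JM/J_sum => // a; apply/JM.
by case: hM => M' _ e; rewrite -mulmxA -e mulmxA hv mul0mx.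
Qed.

End TwoComplexes.

Lemma cycle_exact F (resF : graded_resolution in_degree J F) i
    (v : 'rV_(rk F i)) : cycle v <-> exists w, v = w *m dif F i.
Proof. by case: i v => [|i] v; [apply: (res_exact0 resF) | apply: (res_exact resF)]. Qed.

Lemma resolution_J0 F (resF : graded_resolution in_degree J F) : J 0.
Proof. by apply: J0; have [v ?] := res_surj resF 0; eexists; eassumption. Qed.

Lemma dif_dif F (resF : graded_resolution in_degree J F) i :
  dif F i.+1 *m dif F i = 0.
Proof.
apply/row_matrixP=> a; rewrite row_mul row0.
by apply/(res_exact resF); exists (delta_mx 0 a); rewrite rowE.
Qed.

Section Lifting.
Variables F K : free_complex R.
Hypotheses (resF : graded_resolution in_degree J F).
Hypotheses (resK : graded_resolution in_degree J K).

Lemma chain_lift_cycles i M :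
  chain_lift (K := K) (aug F) (i := i) M -> forall v, cycle v -> cycle (v *m M).
Proof. by move=> lM; apply: (chain_lift_cycle (resolution_J0 resF) _ lM). Qed.

(** Exactness of [K] supplies each row of the next term; passing to homogeneous components at every
    stage keeps the chain map of degree 0. *)
Lemma chain_lift_exists i :
  exists2 M : 'M[R]_(rk F i, rk K i),
    homog_mx (@gdeg _ F i) (@gdeg _ K i) M & chain_lift (aug F) M.
Proof.
elim: i => [|i [M hM lM]].
  have /fin_all_exists[w ew] : forall a : 'I_(rk F 0),
    exists w : 'rV_(rk K 0), J (aug F a 0 - (w *m aug K) 0 0).
    by move=> a; apply: (res_surj resK).
  exists (\matrix_(a, c) comp (gdeg a - gdeg c) (w a 0 c)).
    by move=> a c; rewrite mxE.
  move=> a; have := Jcomp (gdeg a) (ew a).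
  rewrite compD (comp_id (res_homog_aug resF a)) compN.
  rewrite !mxE comp_sum; congr (J (_ - _)); apply: eq_bigr => c _.
  by rewrite mxE (compM _ _ (res_homog_aug resK c)).
have hdM := homog_mxM (res_homog_dif resF (i := i)) hM.
have [|W hW eW] := homog_mx_factor hdM (res_homog_dif resK (i := i)).
  move=> a; rewrite row_mul; apply/(cycle_exact resK).
  apply: chain_lift_cycles lM _ _; apply/(cycle_exact resF).
  by exists (delta_mx 0 a); rewrite rowE.
by exists W => //; exists M.
Qed.

Lemma chain_lift_comp i (M : 'M[R]_(rk F i, rk K i)) (N : 'M[R]_(rk K i, rk F i)) :
  chain_lift (aug F) M -> chain_lift (aug K) N ->
  chain_lift (K := F) (0 : 'cV_(rk F 0)) (M *m N - 1%:M).
Proof.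
elim: i M N => [|i IH] M N /=.
  move=> hM hN a.
  have -> : 0 - (M *m N - 1%:M) *m aug F =
     (aug F - M *m aug K) + M *m (aug K - N *m aug F).
    by rewrite mulmxBl mulmxBr mul1mx mulmxA sub0r opprB addrA addrNK.
  rewrite mxE; apply: JD => //; rewrite mxE; apply: J_sum => [|b].
    exact: resolution_J0 resF.
  exact: JM.
case=> M' hM' eM [N' hN' eN]; exists (M' *m N' - 1%:M); first exact: IH.
by rewrite mulmxBr mulmxBl mulmx1 mul1mx mulmxA eM -!mulmxA eN.
Qed.

End Lifting.

(** A null-homotopy at the single spot [i]. The part [h'] one step lower is only asserted to exist,
    because its contribution vanishes on cycles over the residue field. *)
Definition homotopy (F : free_complex R) i :
    'M[R]_(rk F i) -> 'M[R]_(rk F i, rk F i.+1) -> Prop :=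
  if i is i'.+1 then fun M h => exists h', M = dif F i' *m h' + h *m dif F i'.+1
  else fun M h => M = h *m dif F 0.

Lemma factor_rows m n l (M : 'M[R]_(m, n)) (D : 'M[R]_(l, n)) :
  (forall a, exists w, row a M = w *m D) -> exists W, M = W *m D.
Proof.
move=> /fin_all_exists[w ew]; exists (\matrix_a w a).
by apply/row_matrixP=> a; rewrite row_mul rowK.
Qed.

Lemma lift0_homotopy F (resF : graded_resolution in_degree J F) i M :
  chain_lift (K := F) (0 : 'cV_(rk F 0)) (i := i) M ->
  exists h, homotopy M h.
Proof.
have JJ0 := resolution_J0 resF.
elim: i M => [|i IH] M /=.
  move=> hM; apply: factor_rows => a; apply/(res_exact0 resF).
  have := JM (-1) (hM a); rewrite mulN1r.
  have -> : (- (0 - M *m aug F) a 0) = (row a M *m aug F) 0 0.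
    by rewrite -row_mul sub0r [X in - X]mxE opprK [RHS]mxE.
  by [].
case=> M' /IH[h' hh'] e.
(* By the homotopy formula one step lower, [M' - h' *m dif F i] is zero or starts with a
   differential. *)
have dM : dif F i *m (M' - h' *m dif F i) = 0.
  move: (i) M' h' hh' {IH M e} => [|i'] N h0 /=; first by move=> ->; rewrite subrr mulmx0.
  by case=> h'' ->; rewrite addrK mulmxA dif_dif // mul0mx.
have [h eh] : exists h, M - dif F i *m h' = h *m dif F i.+1.
  apply: factor_rows => a; apply/(res_exact resF).
  by rewrite -row_mul mulmxBl -e -mulmxA -mulmxBr dM row0.
by exists h, h'; rewrite -eh addrC subrK.
Qed.

Local Notation ebar := (map_mx eps).

(** Entries of nonzero degree die in [k], so there a homogeneous matrix is block diagonal by degree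
    and commutes with the projections onto degree [j]. *)
Lemma strandM m n (g : 'I_m -> int) (g' : 'I_n -> int) (M : 'M[R]_(m, n)) j :
  homog_mx g g' M ->
  diag_mx (\row_l (g l == j)%:R) *m ebar M =
  ebar M *m diag_mx (\row_l (g' l == j)%:R).
Proof.
move=> hM; apply/matrixP=> a b; rewrite mul_diag_mx mul_mx_diag !mxE.
have [e|ne] := eqVneq (g a) (g' b); first by rewrite e mulrC.
by rewrite (eps_deg (hM a b)) ?subr_eq0 // mulr0 mul0r.
Qed.

Lemma strand_id (F : free_complex R) i j p (v : 'M_(p, rk F i)) :
  (v <= strand k F i j)%MS -> v *m strand k F i j = v.
Proof.
case/submxP=> w ->; rewrite -mulmxA /strand mulmx_diag.
congr (_ *m diag_mx _); apply/rowP=> l; rewrite !mxE.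
by case: eqP; rewrite ?mulr1 ?mulr0.
Qed.

Lemma residue_dif_dif F (resF : graded_resolution in_degree J F) i :
  residue_dif eps F i.+1 *m residue_dif eps F i = 0.
Proof. by rewrite /residue_dif -map_mxM dif_dif // map_mx0. Qed.

Lemma boundaries_sub F (resF : graded_resolution in_degree J F) i j :
  (boundaries eps F i j <= cycles eps F i :&: strand k F i j)%MS.
Proof.
rewrite sub_capmx; apply/andP; split; last first.
  by rewrite /boundaries /strand (strandM _ (res_homog_dif resF (i := i))) submxMl.
case: i => [|i]; first exact: submx1.
by apply/sub_kermxP; rewrite /boundaries -mulmxA residue_dif_dif // mulmx0.
Qed.

Lemma residue_cycles F K c i (M : 'M_(rk F i, rk K i)) :
  chain_lift c M -> (cycles eps F i *m ebar M <= cycles eps K i)%MS.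
Proof.
case: i M => [|i] M; first by rewrite submx1.
case=> M' _ e; apply/sub_kermxP.
by rewrite -mulmxA -map_mxM -e map_mxM mulmxA mulmx_ker mul0mx.
Qed.

(** The comparison maps [A] and [B] compose to a map homotopic to the identity, so [A] is injective
    on homology. Exchanging the complexes later gives equality. *)
Lemma homology_dim_le F K i j :
  graded_resolution in_degree J F -> graded_resolution in_degree J K ->
  (homology_dim eps F i j <= homology_dim eps K i j)%N.
Proof.
move=> resF resK.
have [M hM lM] := chain_lift_exists resF resK i.
have [N1 hN1 lN1] := chain_lift_exists resK resF i.
pose A := ebar M; pose B := ebar N1.
have [h hh] := lift0_homotopy resF (chain_lift_comp resF lM lN1).
(* [W] continues the chain map [N1] one step up; through it [B] carries boundaries of degree [j] to
   boundaries of degree [j]. *)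
have [W hW eW] : exists2 W, homog_mx (@gdeg _ K i.+1) (@gdeg _ F i.+1) W
     & dif K i *m N1 = W *m dif F i.
  apply: homog_mx_factor (res_homog_dif resF (i := i)) _.
    exact: homog_mxM (res_homog_dif resK (i := i)) hN1.
  move=> a; rewrite row_mul; apply/(cycle_exact resF).
  apply: (chain_lift_cycles resK lN1); apply/(cycle_exact resK).
  by exists (delta_mx 0 a); rewrite rowE.
apply: (mxrank_quotient_inj (A := A)); try exact: boundaries_sub.
  rewrite sub_capmx; apply/andP; split; last first.
    apply: submx_trans (submxMr A (capmxSr _ _)) _.
    by rewrite /strand (strandM _ hM) submxMl.
  apply: submx_trans (submxMr A (capmxSl _ _)) _.
  exact: residue_cycles lM.
move=> z zZ zA; have := zZ; rewrite sub_capmx => /andP[zC zS].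
have zAB : (z *m (A *m B) <= boundaries eps F i j)%MS.
  case/submxP: zA => y; rewrite mulmxA => ->.
  rewrite /boundaries -!mulmxA -map_mxM eW map_mxM.
  rewrite [X in y *m X]mulmxA /strand (strandM _ hW) -!mulmxA mulmxA.
  exact: submxMl.
have zABz : (z *m (A *m B) - z <= boundaries eps F i j)%MS.
  have eAB : z *m (A *m B) - z = z *m ebar (M *m N1 - 1%:M).
    by rewrite map_mxB map_mxM map_mx1 mulmxBr mulmx1.
  have : exists y, z *m (A *m B) - z = y *m residue_dif eps F i.
    rewrite eAB.
    case: (i) M N1 h hh z zC {hM lM hN1 lN1 W hW eW zZ zA zS zAB eAB A B}
       => [|i'] M N1 h /=.
      by move=> -> z _; exists (z *m ebar h); rewrite map_mxM mulmxA.
    case=> h' -> z /sub_kermxP zK; exists (z *m ebar h).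
    by rewrite map_mxD !map_mxM mulmxDr mulmxA zK mul0mx add0r mulmxA.
  case=> y ey.
  (* The homotopy yields a boundary without control of its degree; as the difference lies in degree
     [j], projecting to that strand makes it a boundary of degree [j]. *)
  have -> : z *m (A *m B) - z = (z *m (A *m B) - z) *m strand k F i j.
    have eS : A *m B *m strand k F i j = strand k F i j *m (A *m B).
      by rewrite -mulmxA /strand -(strandM j hN1) mulmxA -(strandM j hM) mulmxA.
    have zSe := strand_id zS.
    by rewrite mulmxBl zSe -[z *m _ *m _]mulmxA eS [z *m (strand _ _ _ _ *m _)]mulmxA zSe.
  rewrite ey /boundaries -mulmxA /strand /residue_dif.
  by rewrite -(strandM j (res_homog_dif resF (i := i))) submxMl.
rewrite -[z](subKr (z *m (A *m B))); apply: addmx_sub => //.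
by rewrite eqmx_opp.
Qed.

Lemma graded_betti_resolution K i j :
  graded_resolution in_degree J K ->
  graded_betti in_degree eps J i j = homology_dim eps K i j.
Proof.
move=> resK; rewrite /graded_betti.
have [|F resF ->] := epsilon_spec (inhabits 0%N) (fun b : nat =>
    exists2 F, graded_resolution in_degree J F & b = homology_dim eps F i j).
  by exists (homology_dim eps K i j); exists K.
by apply/eqP; rewrite eqn_leq !homology_dim_le.
Qed.

End Comparison.

(** * The monomials of three variables and powers of a conic *)

Lemma dvdXn_coef (F : fieldType) (n : nat) (p : {poly F}) :
  (forall i, (i < n)%N -> p`_i = 0) -> 'X^n %| p.
Proof.
move=> p0; rewrite -(poly_take_drop n p) (_ : take_poly n p = 0) ?add0r ?dvdp_mull //.
by apply/polyP=> i; rewrite coef_take_poly coef0; case: ifP => // /p0.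
Qed.

Lemma dvdp_derivn_exp (F : fieldType) (q p : {poly F}) e n :
  q ^+ e %| p -> q ^+ (e - n) %| p^`(n).
Proof.
elim: n => [|n IH] qp; first by rewrite subn0 derivn0.
rewrite derivnS; have [ge|lt] := leqP e n.
  by rewrite (eqP (_ : (e - n.+1)%N == 0%N)) ?expr0 ?dvd1p // subn_eq0 leqW.
have -> : (e - n.+1 = (e - n).-1)%N by rewrite subnS.
case/dvdpP: (IH qp) => u ->; rewrite derivM deriv_exp.
case: (e - n)%N => [|m]; first by rewrite expr0 dvd1p.
apply: dvdp_add; first by rewrite exprS mulrA dvdp_mull.
by rewrite -mulrnAl !dvdp_mull.
Qed.

(* A multiple of [('X - 1) ^+ e] of degree at most D whose coefficients form two
   short blocks, the lower one of length m = D - b + 1: its m-th derivative would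
   have too many zeros at 0 and 1 for its degree, hence vanishes. *)
Lemma truncated_power_inj (F : fieldType) (p a b e D : nat) (h : {poly F}) :
  p \in [pchar F] -> (2 * D + 2 = a + b + e)%N -> (D < a + b)%N ->
  (forall i, (a <= D)%N -> (b <= D)%N ->
    (a + b <= i + D)%N -> (i <= D)%N -> ~~ (p %| i)%N) ->
  (size h <= a)%N -> (size h + e <= D.+1)%N ->
  (forall i, (i + b + e <= D)%N -> h`_i = 0) ->
  (forall i, (D < i + b)%N -> (i < a)%N -> (('X - 1) ^+ e * h)`_i = 0) ->
  h = 0.
Proof.
move=> pF eD abD pD sha shD hlow hF; have [//|h0] := eqVneq h 0; exfalso.
set f := _ * h in hF.
have sf : size f = (e + size h)%N.
  rewrite /f size_monicM ?monic_exp ?monicXsubC //.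
  by rewrite -[1]/(1%:P) size_exp_XsubC addSn.
have f0 : f != 0 by rewrite -size_poly_eq0 sf addn_eq0 size_poly_eq0 (negPf h0) andbF.
have co n m : coprimep ('X^n : {poly F}) (('X - 1) ^+ m).
  apply/coprimep_expl/coprimep_expr; rewrite coprimep_sym coprimepX rootE.
  by rewrite !hornerE oppr_eq0 oner_eq0.
have big i : (D < i)%N -> f`_i = 0.
  by move=> Di; rewrite nth_default // sf; lia.
have no_small n : (n <= e)%N -> (size f <= n)%N -> False.
  by rewrite sf => ne; move: h0; rewrite -size_poly_gt0; lia.
(* Without a lower block ['X^a] divides [f], hence [h], which is too short for that. *)
have [Db|bD] := ltnP D b.
  have : 'X^a %| f by apply: dvdXn_coef => i ia; apply: hF => //; lia.
  rewrite Gauss_dvdpr ?co // => /dvdp_leq; rewrite size_polyXn h0 => /(_ isT).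
  by rewrite ltnNge sha.
(* Without an upper block [f] has size at most D - b + 1, which puts the leading coefficient of [h]
   in the range of [hlow]. *)
have [Da|aD] := ltnP D a.
  have : (size f <= (D - b).+1)%N.
    apply/leq_sizeP => i Di; have [Di'|Di'] := ltnP D i; first exact: big.
    by apply: hF; lia.
  rewrite sf => le.
  have : h`_(size h).-1 = 0.
    by apply: hlow; move: h0; rewrite -size_poly_gt0; lia.
  by move/eqP; rewrite -lead_coefE lead_coef_eq0 (negPf h0).
(* The [n]-th derivative kills the lower block. It is divisible by ['X^(a - n)] and
   [('X - 1) ^+ (e - n)], of total degree at least a + e - 2n = b, while its size is at most [b]. *)
set n := (D - b).+1.
have Fn : f^`(n) = 0.
  have [//|Fn0] := eqVneq f^`(n) 0; exfalso.
  have d1 : ('X - 1) ^+ (e - n) %| f^`(n) by apply/dvdp_derivn_exp/dvdp_mulIl.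
  have d2 : 'X^(a - n) %| f^`(n).
    apply: dvdXn_coef => i ia; rewrite coef_derivn hF ?mul0rn //; lia.
  have : 'X^(a - n) * ('X - 1) ^+ (e - n) %| f^`(n) by rewrite Gauss_dvdp ?co ?d1 ?d2.
  move/dvdp_leq => /(_ Fn0); rewrite size_monicM ?monicXn ?expf_neq0 ?polyXsubC_eq0 //.
  rewrite size_polyXn -[1]/(1%:P) size_exp_XsubC => le1.
  have : (size f^`(n) <= b)%N.
    by apply/leq_sizeP => i bi; rewrite coef_derivn big ?mul0rn //; lia.
  by move=> /(leq_trans le1); rewrite /n; lia.
apply: (no_small n); first by rewrite /n; lia.
apply/leq_sizeP => i ni; have [Di|Di] := ltnP D i; first exact: big.
have [ia|ai] := ltnP i a; first by apply: hF => //; lia.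
(* This coefficient is that of [f] times i(i-1)...(i-n+1), whose factors lie in the range where [pD]
   excludes multiples of [p]. *)
have : (f^`(n))`_(i - n) = 0 by rewrite Fn coef0.
rewrite coef_derivn subnKC // => /eqP; rewrite -mulr_natr mulf_eq0.
case/orP => [/eqP //|]; rewrite -(dvdn_pcharf pF) ffact_prod.
rewrite Euclid_dvd_prod ?(pcharf_prime pF) // big_has => /hasP[j _].
by rewrite (negPf (pD _ _ _ _ _)) //; have := ltn_ord j; lia.
Qed.

Definition o0 : 'I_3 := @Ordinal 3 0 isT.
Definition o1 : 'I_3 := @Ordinal 3 1 isT.
Definition o2 : 'I_3 := @Ordinal 3 2 isT.

Lemma ord3P (P : 'I_3 -> Prop) : P o0 -> P o1 -> P o2 -> forall i, P i.
Proof.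
move=> P0 P1 P2 [[|[|[|//]]] lt].
- by have -> : Ordinal lt = o0 by apply: val_inj.
- by have -> : Ordinal lt = o1 by apply: val_inj.
- by have -> : Ordinal lt = o2 by apply: val_inj.
Qed.

Lemma sum3 (V : nmodType) (F : 'I_3 -> V) : \sum_i F i = F o0 + F o1 + F o2.
Proof.
rewrite !big_ord_recr big_ord0 /= add0r.
by congr (F _ + F _ + F _); apply: val_inj.
Qed.

Definition mnm3 (a b c : nat) : 'X_{1..3} := [multinom [tuple a; b; c]].

Lemma mnm3E0 a b c : mnm3 a b c o0 = a. Proof. by []. Qed.
Lemma mnm3E1 a b c : mnm3 a b c o1 = b. Proof. by []. Qed.
Lemma mnm3E2 a b c : mnm3 a b c o2 = c. Proof. by []. Qed.
Definition mnm3E := (mnm3E0, mnm3E1, mnm3E2).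

Lemma mnm3_eta (m : 'X_{1..3}) : m = mnm3 (m o0) (m o1) (m o2).
Proof. by apply/mnmP; apply: ord3P. Qed.

Lemma mdeg3 (m : 'X_{1..3}) : mdeg m = (m o0 + m o1 + m o2)%N.
Proof. by rewrite mdegE sum3. Qed.

Lemma lem3 (m m' : 'X_{1..3}) :
  (m <= m')%MM = [&& (m o0 <= m' o0)%N, (m o1 <= m' o1)%N & (m o2 <= m' o2)%N].
Proof. by apply/mnm_lepP/and3P => [h|[? ? ?]]; [split|apply: ord3P]. Qed.

Lemma mcoeffXM (n : nat) (R : nzRingType) (m k : 'X_{1..n}) (g : {mpoly R[n]}) :
  ('X_[m] * g)@_k = if (m <= k)%MM then g@_(k - m)%MM else 0.
Proof.
case: ifP => [le|nle].
  by rewrite -{1}(submK le) addmC -commr_mpolyX mcoeffMX.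
apply: memN_msupp_eq0; rewrite -commr_mpolyX (perm_mem (msuppMX _ _)).
by apply/mapP => -[m' _ e]; move: nle; rewrite e lem_addr.
Qed.

(** * Injectivity of multiplication by a power of the conic *)

Section ConicPower.
Variable k : fieldType.
Implicit Types g : {mpoly k[3]}.

Definition conic : {mpoly k[3]} := 'X_[mnm3 1 1 0] - 'X_[mnm3 0 0 2].

(** The flag [s] records which of x and y has the larger exponent, so that weights are natural
    numbers. *)
Definition slice_mnm (s : bool) a b c := if s then mnm3 b a c else mnm3 a b c.

(* [conic] preserves the torus weight w = |m0 - m1|; on the part of weight w it
   acts as multiplication by [u - v] with [u = xy] and [v = z^2], which becomes
   ['X - 1] after setting [v = 1]. *)
Definition slice (s : bool) (w n : nat) g : {poly k} :=
  \poly_(i < n.+1)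
    if (w + i.*2 <= n)%N then g@_(slice_mnm s (i + w) i (n - (w + i.*2))) else 0.

Lemma coef_slice s w n g i : (slice s w n g)`_i =
  if (w + i.*2 <= n)%N then g@_(slice_mnm s (i + w) i (n - (w + i.*2))) else 0.
Proof. by rewrite coef_poly; case: ifP => //; case: ifP => //; lia. Qed.

Lemma slice_conic s w n g : slice s w n.+2 (conic * g) = ('X - 1) * slice s w n g.
Proof.
apply/polyP=> i; rewrite [in RHS]mulrBl mul1r coefB coefXM !coef_slice.
rewrite mulrBl mcoeffB !mcoeffXM.
have -> : (mnm3 1 1 0 <= slice_mnm s (i + w) i (n.+2 - (w + i.*2)))%MM = (0 < i)%N.
  by rewrite lem3 /slice_mnm; case: s; rewrite !mnm3E; lia.
have -> : (mnm3 0 0 2 <= slice_mnm s (i + w) i (n.+2 - (w + i.*2)))%MM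
  = (w + i.*2 <= n)%N.
  by rewrite lem3 /slice_mnm; case: s; rewrite !mnm3E; lia.
have -> : (slice_mnm s (i + w) i (n.+2 - (w + i.*2)) - mnm3 0 0 2)%MM
   = slice_mnm s (i + w) i (n - (w + i.*2)).
  by apply/mnmP; rewrite /slice_mnm; case: s; apply: ord3P; rewrite mnmBE !mnm3E; lia.
case: i => [|i] /=; first by case: ifP => ?; case: ifP => ?; rewrite ?subrr //; lia.
rewrite (_ : (w + i.+1.*2 <= n.+2)%N = (w + i.*2 <= n)%N); last by lia.
case: ifP => h; last by rewrite ifF ?subrr //; lia.
congr (_@_ _ - _); apply/mnmP; rewrite /slice_mnm.
by case: s; apply: ord3P; rewrite mnmBE !mnm3E; lia.
Qed.

Lemma slice_conicX s w n e g :
  slice s w (n + e.*2) (conic ^+ e * g) = ('X - 1) ^+ e * slice s w n g.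
Proof.
elim: e => [|e IH]; first by rewrite !expr0 !mul1r addn0.
by rewrite doubleS !addnS !exprS -!mulrA slice_conic IH.
Qed.

Definition reduced_mnm q (m : 'X_{1..3}) := [&& (m o0 < q)%N, (m o1 < q)%N & (m o2 < q)%N].

Lemma conic_power_inj (p t r e : nat) g :
  p \in [pchar k] -> (p ^ t = r.*2.+1)%N -> (0 < t)%N -> (e.*2 < p)%N -> (e < r)%N ->
  g \is (3 * r - e)%N.-homog ->
  (forall m, ~~ reduced_mnm r.*2.+1 m -> g@_m = 0) ->
  (forall m, mdeg m = (3 * r + e)%N -> reduced_mnm r.*2.+1 m ->
     (conic ^+ e * g)@_m = 0) ->
  g = 0.
Proof.
move=> pk eq t0 ep er gh gr gq.
have slice0 s w : slice s w (3 * r - e) g = 0.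
  have unred i : ((r.*2 < i + w) || (r.*2 < 3 * r - e - (w + i.*2)))%N ->
      (slice s w (3 * r - e) g)`_i = 0.
    move=> h; rewrite coef_slice; case: ifP => // _; apply: gr.
    by rewrite /reduced_mnm /slice_mnm; case: s; rewrite !mnm3E; lia.
  have [wn|nw] := ltnP (3 * r - e) w.
    by apply/polyP=> i; rewrite coef_slice coef0 ifF //; lia.
  have [wr|rw] := ltnP r.*2 w.
    by apply/polyP=> i; rewrite coef0 unred //; lia.
  have [D [u [uD uw]]] : exists D, exists u : bool, (3 * r + e - w = D.*2 + u)%N /\ true.
    by exists (3 * r + e - w)./2, (odd (3 * r + e - w)); split=> //; lia.
  (* Here 3r + e - w = 2D + u with [u] the parity. In the product, the exponent i + w is below [q]
     iff i < 2r + 1 - w, and the exponent 2(D - i) + u of z is below [q] iff D < i + (r + 1 - u).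
     These bounds are the [a] and [b] of the lemma. *)
  apply: (@truncated_power_inj _ p (r.*2.+1 - w) (r.+1 - u) e D) => //; try lia.
  (* The range gives r - e < i < r + e. As q/p is odd, the multiples of [p] around r are r - (p-1)/2
     and r + (p+1)/2, and 2e < p puts both outside. *)
  - move=> i aD bD i1 i2; apply/negP => /dvdnP[v ev].
    have [t' et] : exists t', t = t'.+1 by exists t.-1; lia.
    have oq : odd (p ^ t').
      by have := congr1 odd eq; rewrite et expnS oddM /= odd_double => /andP[].
    have eq' : (p * ((p ^ t')./2.*2 + 1) = r.*2.+1)%N.
      by rewrite -eq et expnS -[in RHS](odd_double_half (p ^ t')) oq addnC.
    have [vx|xv] := leqP v (p ^ t')./2.
      by have := leq_mul (leqnn p) vx; lia.
    by have := leq_mul (leqnn p) xv; lia.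
  - apply/leq_sizeP => i i1; apply: unred; lia.
  - suff : (size (slice s w (3 * r - e) g) <= D.+1 - e)%N by lia.
    by apply/leq_sizeP => i i1; rewrite coef_slice ifF //; lia.
  - by move=> i i1; apply: unred; lia.
  move=> i i1 i2; rewrite -slice_conicX coef_slice; case: ifP => // h.
  have -> : (3 * r - e + e.*2 = 3 * r + e)%N by lia.
  apply: gq; rewrite /reduced_mnm ?mdeg3 /slice_mnm; case: s {unred}; rewrite !mnm3E; lia.
apply/mpolyP=> m; rewrite mcoeff0.
have [dm|/(dhomog_nemf_coeff gh) //] := eqVneq (mdeg m) (3 * r - e)%N.
pose s := (m o0 < m o1)%N; pose i := minn (m o0) (m o1).
pose w := (maxn (m o0) (m o1) - i)%N.
have := congr1 (fun f : {poly k} => f`_i) (slice0 s w).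
rewrite /= coef_slice coef0 ifT; last by move: dm; rewrite mdeg3 /w /i; lia.
move=> <-; congr (g@_ _); rewrite [LHS]mnm3_eta; apply/mnmP.
move: dm; rewrite mdeg3 /slice_mnm /s /w /i => dm.
by case: ifP => h; apply: ord3P; rewrite !mnm3E; lia.
Qed.
End ConicPower.

(** * Multiplication by f modulo x^q, y^q, z^q *)

Section FrobeniusPower.
Variables (k : fieldType) (q : nat).
Local Notation P := {mpoly k[3]}.
Implicit Types (v w : 'rV[P]_3) (g p : P).

Definition theta v : P := \sum_l v 0 l * 'X_l ^+ q.

Definition hrow n m (v : 'rV[P]_m) := forall l, v 0 l \is n.-homog.

Lemma thetaD v w : theta (v + w) = theta v + theta w.
Proof. by rewrite -big_split; apply: eq_bigr => l _; rewrite mxE mulrDl. Qed.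

Lemma thetaZ c v : theta (c *: v) = c * theta v.
Proof. by rewrite mulr_sumr; apply: eq_bigr => l _; rewrite mxE mulrA. Qed.

Lemma thetaB v w : theta (v - w) = theta v - theta w.
Proof. by rewrite thetaD -scaleN1r thetaZ mulN1r. Qed.

Lemma theta0 : theta 0 = 0.
Proof. by rewrite -(scale0r (0 : 'rV[P]_3)) thetaZ mul0r. Qed.

Lemma theta_coef v m :
  (theta v)@_m = \sum_l if (q <= m l)%N then (v 0 l)@_(m - U_(l) *+ q)%MM else 0.
Proof.
rewrite raddf_sum; apply: eq_bigr => l _; rewrite /= mulrC mpolyXn mcoeffXM.
congr (if _ then _ else _); apply/mnm_lepP/idP => [/(_ l)|h i].
  by rewrite mulmnE mnm1E eqxx mul1n.
by rewrite mulmnE mnm1E; case: eqP => [<-|_]; rewrite ?mul1n // mul0n.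
Qed.

Lemma theta_reduced v m : reduced_mnm q m -> (theta v)@_m = 0.
Proof.
move=> /and3P[m0 m1 m2]; rewrite theta_coef big1 // => l _.
suff -> : (q <= m l)%N = false by [].
by apply/negbTE; rewrite -ltnNge; move: l; apply: ord3P.
Qed.

Lemma homog_theta n v : hrow n v -> theta v \is (n + q).-homog.
Proof.
move=> hv; apply: rpred_sum => l _; apply: dhomogM => //.
by rewrite mpolyXn dhomogX /= mdegMn mdeg1 mul1n.
Qed.

(** A monomial of degree below [q] times X_l^q is divisible by no other X_i^q, so the three summands
    of [theta] cannot cancel. *)
Lemma theta_inj n v : (n < q)%N -> hrow n v -> theta v = 0 -> v = 0.
Proof.
move=> nq hv v0; apply/rowP => l; rewrite mxE; apply/mpolyP => m; rewrite mcoeff0.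
have [dm|/(dhomog_nemf_coeff (hv l)) //] := eqVneq (mdeg m) n.
have : (theta v)@_(m + U_(l) *+ q)%MM = 0 by rewrite v0 mcoeff0.
rewrite theta_coef (bigD1 l) //= big1 ?addr0 => [|i il].
  by rewrite addmK mnmDE mulmnE mnm1E eqxx mul1n leq_addl.
rewrite mnmDE mulmnE mnm1E eq_sym (negPf il) mul0n addn0 ifF //.
apply/negbTE; rewrite -ltnNge (leq_ltn_trans _ nq) // -dm mdegE.
by rewrite (bigD1 i) //= leq_addr.
Qed.

(** Monomials are sorted: those divisible by some X_l^q go into [v]. Such a monomial has degree at
    least [q], so the truncated [n - q] is exact for it. *)
Lemma theta_reduce n g : g \is n.-homog ->
  exists g0 v, [/\ g = g0 + theta v, g0 \is n.-homog,
    forall m, ~~ reduced_mnm q m -> g0@_m = 0 & hrow (n - q)%N v].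
Proof.
move=> /dhomogP hg; rewrite {1}(mpolyE g) big_seq.
elim/big_ind: _ => [|g1 g2 [a1 [v1 [-> h1 r1 hv1]]] [a2 [v2 [-> h2 r2 hv2]]]|m mg].
- exists 0, 0; split; rewrite ?rpred0 ?theta0 ?addr0 //; first by move=> m; rewrite mcoeff0.
  by move=> l; rewrite mxE rpred0.
- exists (a1 + a2), (v1 + v2); split; rewrite ?rpredD ?thetaD 1?addrACA //.
    by move=> m rm; rewrite mcoeffD r1 // r2 // addr0.
  by move=> l; rewrite mxE rpredD.
have dm := hg _ mg; have hm : 'X_[m] \is [in k[3], n.-homog] by rewrite dhomogX dm.
have [rm|rm] := boolP (reduced_mnm q m).
  exists (g@_m *: 'X_[m]), 0; split; rewrite ?theta0 ?addr0 ?rpredZ //.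
    move=> m' rm'; rewrite mcoeffZ mcoeffX; case: eqP => [e|_]; last by rewrite mulr0.
    by rewrite -e rm in rm'.
  by move=> l; rewrite mxE rpred0.
have [l ql] : exists l, (q <= m l)%N.
  move: rm; rewrite /reduced_mnm !negb_and -!leqNgt.
  by case/or3P => ?; [exists o0|exists o1|exists o2].
have le : (U_(l) *+ q <= m)%MM.
  apply/mnm_lepP => i; rewrite mulmnE mnm1E.
  by case: eqP => [<-|_]; rewrite ?mul1n // mul0n.
exists 0, (\row_i if i == l then g@_m *: 'X_[m - U_(l) *+ q] else 0); split.
- rewrite add0r /theta (bigD1 l) //= big1 ?addr0 => [|i /negPf il].
    by rewrite mxE eqxx mpolyXn -scalerAl -mpolyXD submK.
  by rewrite mxE il mul0r.
- exact: rpred0.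
- by move=> m' _; rewrite mcoeff0.
move=> i; rewrite mxE; case: eqP => _; last exact: rpred0.
rewrite rpredZ // dhomogX /=; apply/eqP.
have := congr1 (@mdeg 3) (submK le); rewrite mdegD mdegMn mdeg1 dm mul1n => <-.
by rewrite addnK.
Qed.

Lemma theta_of_coef n p : p \is n.-homog ->
  (forall m, mdeg m = n -> reduced_mnm q m -> p@_m = 0) ->
  exists2 v, hrow (n - q)%N v & p = theta v.
Proof.
move=> hp p0; have [g0 [v [ep h0 r0 hv]]] := theta_reduce hp.
exists v => //; rewrite ep (_ : g0 = 0) ?add0r //; apply/mpolyP=> m; rewrite mcoeff0.
have [rm|/r0 //] := boolP (reduced_mnm q m).
have [dm|/(dhomog_nemf_coeff h0) //] := eqVneq (mdeg m) n.
by have := p0 _ dm rm; rewrite ep mcoeffD theta_reduced // addr0.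
Qed.

End FrobeniusPower.

(** * Multiplication by f as a square matrix *)

Section MultiplicationMatrix.
Variables (R : nzRingType) (q n : nat).

Definition reduced_monomials : {set 'X_{1..3 < n.+1}} :=
  [set m : 'X_{1..3 < n.+1} | (mdeg m == n) && reduced_mnm q m].

Definition rmon (i : 'I_#|reduced_monomials|) : 'X_{1..3} := enum_val i.

(** The socle monomial of k[x,y,z]/(x^q,y^q,z^q). Complementation in it pairs the reduced monomials
    of degree n with those of degree 3(q-1) - n, so that bijectivity becomes a nonzero
    determinant. *)
Definition top_mnm := mnm3 q.-1 q.-1 q.-1.

(* For [c m = f@_m] this is the matrix of multiplication by f from degree n to
   degree 3(q-1)-n of k[x,y,z]/(x^q,y^q,z^q), the basis of the target being the
   monomials complementary to those of the source. *)
Definition mul_mx (c : 'X_{1..3} -> R) : 'M[R]_#|reduced_monomials| :=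
  \matrix_(i, j) if (rmon i + rmon j <= top_mnm)%MM
                 then c (top_mnm - (rmon i + rmon j))%MM else 0.

Lemma rmonP i : mdeg (rmon i) = n /\ reduced_mnm q (rmon i).
Proof. by have := enum_valP i; rewrite inE => /andP[/eqP]. Qed.

Lemma rmon_surj m : mdeg m = n -> reduced_mnm q m -> exists i, m = rmon i.
Proof.
move=> dm rm; have lt : (mdeg m < n.+1)%N by rewrite dm.
have mS : BMultinom lt \in reduced_monomials by rewrite inE /= dm eqxx.
by exists (enum_rank_in mS (BMultinom lt)); rewrite /rmon enum_rankK_in.
Qed.

Lemma rmon_inj : injective rmon.
Proof. by move=> i j /val_inj /enum_val_inj. Qed.

End MultiplicationMatrix.

Section MultiplicationMatrixField.
Variables (k : fieldType) (q n N : nat) (f : {mpoly k[3]}).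
Hypotheses (q_gt0 : (0 < q)%N) (nN : (n + N = 3 * q.-1)%N).
Local Notation P := {mpoly k[3]}.
Local Notation I := 'I_#|reduced_monomials q n|.
Local Notation M := (mul_mx q n (fun m => f@_m)).

Let comb (v : 'rV[k]_#|reduced_monomials q n|) : P :=
  \sum_i v 0 i *: 'X_[rmon i].

Lemma comb_coef v i : (comb v)@_(rmon i) = v 0 i.
Proof.
rewrite raddf_sum (bigD1 i) //= big1 ?addr0 => [|j ji].
  by rewrite mcoeffZ mcoeffX eqxx mulr1.
by rewrite mcoeffZ mcoeffX (inj_eq (@rmon_inj q n)) (negPf ji) mulr0.
Qed.

Lemma comb_homog v : comb v \is n.-homog.
Proof.
by apply: rpred_sum => i _; rewrite rpredZ // dhomogX /= (rmonP i).1.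
Qed.

Lemma comb_reduced v m : ~~ reduced_mnm q m -> (comb v)@_m = 0.
Proof.
move=> rm; rewrite raddf_sum big1 //= => i _; rewrite mcoeffZ mcoeffX.
by case: eqP => [e|_]; rewrite ?mulr0 //; rewrite -e (rmonP i).2 in rm.
Qed.

Lemma combE g : g \is n.-homog -> (forall m, ~~ reduced_mnm q m -> g@_m = 0) ->
  g = comb (\row_i g@_(rmon i)).
Proof.
move=> hg rg; apply/mpolyP => m; have [rm|rm] := boolP (reduced_mnm q m); last first.
  by rewrite rg // comb_reduced.
have [dm|dm] := eqVneq (mdeg m) n; last first.
  by rewrite (dhomog_nemf_coeff hg) // (dhomog_nemf_coeff (comb_homog _)).
by have [i ->] := rmon_surj dm rm; rewrite comb_coef mxE.
Qed.

Lemma mul_mx_coef v j : (v *m M) 0 j = (f * comb v)@_(top_mnm q - rmon j)%MM.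
Proof.
rewrite mxE mulr_sumr raddf_sum; apply: eq_bigr => i _ /=.
rewrite -scalerAr mcoeffZ; congr (_ * _); rewrite mxE [f * _]mulrC mcoeffXM.
have /and3P[j0 j1 j2] := (rmonP j).2.
have -> : (rmon i <= top_mnm q - rmon j)%MM = (rmon i + rmon j <= top_mnm q)%MM.
  by rewrite !lem3 !mnmDE !mnmBE /top_mnm !mnm3E; lia.
case: ifP => // _; congr (_@_ _); apply/mnmP => l; rewrite !mnmBE mnmDE; lia.
Qed.

Lemma complement_reduced m : mdeg m = N -> reduced_mnm q m ->
  exists j : I, m = (top_mnm q - rmon j)%MM.
Proof.
move=> dm rm; have /and3P[m0 m1 m2] := rm.
have [||j ej] := @rmon_surj q n (top_mnm q - m)%MM.
- by move: dm; rewrite !mdeg3 !mnmBE /top_mnm !mnm3E; lia.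
- by rewrite /reduced_mnm !mnmBE /top_mnm !mnm3E; lia.
exists j; rewrite -ej; apply/mnmP; apply: ord3P; rewrite !mnmBE /top_mnm !mnm3E; lia.
Qed.

Lemma mul_mx_inj g : \det M != 0 -> g \is n.-homog ->
  (forall m, ~~ reduced_mnm q m -> g@_m = 0) ->
  (forall m, mdeg m = N -> reduced_mnm q m -> (f * g)@_m = 0) -> g = 0.
Proof.
move=> dM hg rg fg; pose v : 'rV[k]_#|reduced_monomials q n| := \row_i g@_(rmon i).
have eg := combE hg rg.
have vM : v *m M = 0.
  apply/rowP => j; rewrite mul_mx_coef mxE -eg; apply: fg.
    have /and3P[m0 m1 m2] := (rmonP j).2; have := (rmonP j).1.
    by rewrite !mdeg3 !mnmBE /top_mnm !mnm3E; lia.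
  by rewrite /reduced_mnm !mnmBE /top_mnm !mnm3E; lia.
suff v0 : v = 0 by rewrite eg -/v v0 /comb big1 // => i _; rewrite mxE scale0r.
have uM : M \in unitmx by rewrite unitmxE unitfE.
by rewrite -(mulmxK uM v) vM mul0mx.
Qed.

Lemma mul_mx_det :
  (forall g, g \is n.-homog -> (forall m, ~~ reduced_mnm q m -> g@_m = 0) ->
     (forall m, mdeg m = N -> reduced_mnm q m -> (f * g)@_m = 0) -> g = 0) ->
  \det M != 0.
Proof.
move=> inj; apply/det0P => -[v v0 vM]; move/eqP: v0; apply.
have c0 : comb v = 0.
  apply: inj; [exact: comb_homog | exact: comb_reduced | move=> m dm rm].
  by have [j ->] := complement_reduced dm rm; rewrite -mul_mx_coef vM mxE.
by apply/rowP => i; rewrite -comb_coef c0 mcoeff0 mxE.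
Qed.

(** Inverting the matrix matches all reduced coefficients of [p] with those of a multiple of [f];
    what remains has no reduced monomial and comes from [theta]. *)
Lemma mul_mx_surj d p : \det M != 0 -> f \is d.-homog -> (d + n = N)%N ->
  p \is N.-homog ->
  exists g v, [/\ g \is n.-homog, hrow (N - q)%N v & p = f * g + theta q v].
Proof.
move=> dM hf dN hp.
have uM : M \in unitmx by rewrite unitmxE unitfE.
pose w := (\row_j p@_(top_mnm q - rmon (q := q) (n := n) j)%MM) *m invmx M.
have hfw : f * comb w \is N.-homog by rewrite -dN dhomogM // comb_homog.
have [||v hv ev] := @theta_of_coef k q N (p - f * comb w).
- by rewrite rpredB.
- move=> m dm rm; have [j ->] := complement_reduced dm rm.
  by rewrite mcoeffB -mul_mx_coef mulmxKV // mxE subrr.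
by exists (comb w), v; split; rewrite ?comb_homog // -ev addrC subrK.
Qed.

End MultiplicationMatrixField.

(** * Normal forms modulo f *)

Section HomogeneousComponents.
Variables (k : fieldType) (n : nat).
Implicit Types p g : {mpoly k[n]}.

Lemma pihomogM i d p g : g \is d.-homog ->
  pihomog mdeg (i + d) (p * g) = pihomog mdeg i p * g.
Proof.
move=> hg; rewrite (mpolyE p) mulr_suml !raddf_sum mulr_suml.
apply: eq_bigr => m _ /=; rewrite -scalerAl !linearZ -scalerAl /=; congr (_ *: _).
have hm : 'X_[m] * g \is (mdeg m + d).-homog by rewrite dhomogM // dhomogX.
rewrite pihomogX; case: eqP => [<-|/eqP ne]; first by rewrite pihomog_dE.
by rewrite (pihomog_ne0 _ hm) ?mul0r // eqn_add2r.
Qed.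

Lemma pihomogM_lt i d p g : g \is d.-homog -> (i < d)%N ->
  pihomog mdeg i (p * g) = 0.
Proof.
move=> hg id; rewrite (mpolyE p) mulr_suml raddf_sum big1 // => m _ /=.
rewrite -scalerAl linearZ /=.
have hm : 'X_[m] * g \is (mdeg m + d).-homog by rewrite dhomogM // dhomogX.
by rewrite (pihomog_ne0 _ hm) ?scaler0 // neq_ltn ltn_addl ?orbT.
Qed.

Lemma homog_dvd d i p g h : g \is d.-homog -> p \is (i + d).-homog -> p = h * g ->
  p = pihomog mdeg i h * g.
Proof. by move=> hg hp e; rewrite -(pihomogM _ _ hg) -e pihomog_dE. Qed.

Lemma homogX i : 'X_i \is [in k[n], 1.-homog].
Proof. by rewrite dhomogX /= mdeg1. Qed.

Lemma homog_XM i j p : p \is j.-homog -> 'X_i * p \is j.+1.-homog.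
Proof. by move=> hp; rewrite -add1n dhomogM ?homogX. Qed.

Lemma homog_split_var (l : 'I_n) i p : p \is i.-homog ->
  (forall m : 'X_{1..n}, m l = 0%N -> p@_m = 0) ->
  exists2 r, r \is i.-1.-homog & p = 'X_l * r.
Proof.
move=> /dhomogP hp p0.
exists (\sum_(m <- msupp p) p@_m *: 'X_[m - U_(l)]).
  rewrite big_seq; apply: rpred_sum => m mp; rewrite rpredZ // dhomogX /=.
  have ml : (U_(l) <= m)%MM.
    by rewrite lep1mP; apply: contraL mp => /eqP /p0; rewrite mcoeff_msupp => ->; rewrite eqxx.
  by have := congr1 (@mdeg _) (submK ml); rewrite mdegD mdeg1 (hp _ mp) addn1 => <-.
rewrite {1}(mpolyE p) mulr_sumr big_seq [RHS]big_seq; apply: eq_bigr => m mp.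
have ml : (U_(l) <= m)%MM.
  by rewrite lep1mP; apply: contraL mp => /eqP /p0; rewrite mcoeff_msupp => ->; rewrite eqxx.
by rewrite -scalerAr mulrC -mpolyXD submK.
Qed.

End HomogeneousComponents.

Local Notation x := ('X_o0).
Local Notation y := ('X_o1).
Local Notation z := ('X_o2).

Lemma homog_decomp3 (k : fieldType) i (p : {mpoly k[3]}) : p \is i.+1.-homog ->
  exists p0 p1 p2, [/\ p0 \is i.-homog, p1 \is i.-homog, p2 \is i.-homog
    & p = x * p0 + y * p1 + z * p2].
Proof.
move=> /dhomogP hp; rewrite {1}(mpolyE p) big_seq.
elim/big_ind: _ => [|_ _ [a0 [a1 [a2 [? ? ? ->]]]] [b0 [b1 [b2 [? ? ? ->]]]]|m mp].
- by exists 0, 0, 0; rewrite !rpred0 !mulr0 !addr0.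
- exists (a0 + b0), (a1 + b1), (a2 + b2); rewrite !rpredD // !mulrDr addrACA.
  by split=> //; congr (_ + _); rewrite addrACA.
have key l : m l != 0%N -> exists2 r, r \is i.-homog & p@_m *: 'X_[m] = 'X_l * r.
  rewrite -lep1mP => ml; exists (p@_m *: 'X_[m - U_(l)]).
    rewrite rpredZ // dhomogX /=.
    by have := congr1 (@mdeg _) (submK ml); rewrite mdegD mdeg1 (hp _ mp) addn1 => -[->].
  by rewrite -scalerAr mulrC -mpolyXD submK.
have [/key[r hr ->]|/negPn/eqP m0] := boolP (m o0 != 0%N).
  by exists r, 0, 0; rewrite !rpred0 !mulr0 !addr0.
have [/key[r hr ->]|/negPn/eqP m1] := boolP (m o1 != 0%N).
  by exists 0, r, 0; rewrite !rpred0 !mulr0 addr0 add0r.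
have /key[r hr ->] : m o2 != 0%N 
  by have := hp _ mp; rewrite /= mdeg3 m0 m1 => e; rewrite -lt0n -[m o2]add0n e.
by exists 0, 0, r; rewrite !rpred0 !mulr0 !add0r.
Qed.

(** * Reduction modulo x and f *)

Section ModF.
Variables (k : fieldType) (d : nat) (f : {mpoly k[3]}).
Local Notation P := {mpoly k[3]}.
Implicit Types (p g h r : P) (a b c : nat -> k).

Definition modf p := exists h, p = h * f.

Lemma modf0 : modf 0. Proof. by exists 0; rewrite mul0r. Qed.
Lemma modfD p g : modf p -> modf g -> modf (p + g).
Proof. by case=> a -> [b ->]; exists (a + b); rewrite mulrDl. Qed.
Lemma modfMl p g : modf g -> modf (p * g).
Proof. by case=> a ->; exists (p * a); rewrite mulrA. Qed.
Lemma modfN p : modf p -> modf (- p).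
Proof. by case=> a ->; exists (- a); rewrite mulNr. Qed.
Lemma modfB p g : modf p -> modf g -> modf (p - g).
Proof. by move=> ? ?; apply/modfD => //; apply: modfN. Qed.
Lemma modf_sum (I : finType) (F : I -> P) : (forall i, modf (F i)) -> modf (\sum_i F i).
Proof. by move=> hF; elim/big_ind: _ => //; [apply: modf0|apply: modfD]. Qed.
Lemma modf_refl : modf f. Proof. by exists 1; rewrite mul1r. Qed.

(** For [f] monic in z of degree d and n >= d - 1, the case L = d represents degree n of P/(x,f).
    The sequence [a] is independent of [n], so that multiplication by y only raises [n]. *)
Definition yzform n L a : P := \sum_(i < L) a i *: 'X_[mnm3 0 (n - i) i].

Lemma yzform_homog n L a : (L <= n.+1)%N -> yzform n L a \is n.-homog.
Proof.
move=> Ln; apply: rpred_sum => i _; rewrite rpredZ // dhomogX /= mdeg3 !mnm3E.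
by have := ltn_ord i => ?; apply/eqP; lia.
Qed.

Lemma yzformD n L a b : yzform n L (fun i => a i + b i) = yzform n L a + yzform n L b.
Proof. by rewrite -big_split; apply: eq_bigr => i _; rewrite scalerDl. Qed.

Lemma yzformZ n L s a : yzform n L (fun i => s * a i) = s *: yzform n L a.
Proof. by rewrite scaler_sumr; apply: eq_bigr => i _; rewrite scalerA. Qed.

Lemma yzform_sum n L (I : finType) (A : I -> nat -> k) :
  yzform n L (fun i => \sum_j A j i) = \sum_j yzform n L (A j).
Proof. by rewrite exchange_big; apply: eq_bigr => i _; rewrite scaler_suml. Qed.

Lemma yzform_mul n m L a : (L <= n.+1)%N ->
  y ^+ m * yzform n L a = yzform (m + n) L a.
Proof.
move=> Ln; rewrite mulr_sumr; apply: eq_bigr => i _.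
rewrite -scalerAr mpolyXn -mpolyXD; congr (_ *: 'X_[_]); apply/mnmP.
have := ltn_ord i => ?.
by apply: ord3P; rewrite mnmDE mulmnE mnm1E !mnm3E /= ?mul0n ?mul1n //; lia.
Qed.

Lemma homog_mod_x n g : g \is n.-homog ->
  exists2 r, r \is n.-1.-homog &
    g = x * r + yzform n n.+1 (fun i => g@_(mnm3 0 (n - i) i)).
Proof.
move=> hg; set u := yzform _ _ _.
have [||r hr er] := @homog_split_var k 3 o0 n (g - u).
- by rewrite rpredB // yzform_homog.
- move=> m m0; rewrite mcoeffB.
  have [dm|dm] := eqVneq (mdeg m) n; last first.
    rewrite (dhomog_nemf_coeff hg) // (dhomog_nemf_coeff (yzform_homog _ _)) ?subrr //.
  have m2 : (m o2 < n.+1)%N by move: dm; rewrite mdeg3; lia.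
  have em : m = mnm3 0 (n - m o2) (m o2).
    rewrite {1}[m]mnm3_eta; apply/mnmP; apply: ord3P; rewrite !mnm3E //.
    by move: dm; rewrite mdeg3; lia.
  rewrite [u@_m]raddf_sum (bigD1 (Ordinal m2)) //= big1 ?addr0 => [|i im2].
    by rewrite mcoeffZ mcoeffX -em eqxx mulr1 subrr.
  rewrite mcoeffZ mcoeffX; case: eqP => [e|]; last by rewrite mulr0.
  by move: im2; rewrite -val_eqE /= -e mnm3E eqxx.
by exists r => //; rewrite -er subrK.
Qed.

(* Reduction modulo x, dehomogenized at y = 1. *)
Definition dehom : {rmorphism P -> {poly k}} :=
  mmap (@polyC k) (fun i : 'I_3 => [:: 0; 1; 'X]`_i).

Lemma dehom_x : dehom x = 0.
Proof. by rewrite /dehom /= mmapX mmap1U. Qed.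

Lemma dehom_yz (b c : nat) : dehom 'X_[mnm3 0 b c] = 'X^c.
Proof.
rewrite /dehom /= mmapX /mmap1 !big_ord_recr big_ord0 /= !mul1r.
by rewrite expr1n mul1r.
Qed.

Lemma dehom_yzform n L a : dehom (yzform n L a) = \poly_(i < L) a i.
Proof.
rewrite raddf_sum poly_def; apply: eq_bigr => i _ /=.
by rewrite -mul_mpolyC rmorphM /= dehom_yz /dehom /= mmapC mul_polyC.
Qed.

Hypotheses (d_gt0 : (0 < d)%N) (f_homog : f \is d.-homog).
Hypothesis (f_monic : f@_(mnm3 0 0 d) != 0).

Lemma size_dehom_f : size (dehom f) = d.+1.
Proof.
have [r _ ->] := homog_mod_x f_homog.
rewrite rmorphD rmorphM /= dehom_x mul0r add0r dehom_yzform size_poly_eq //.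
by rewrite subnn.
Qed.

Lemma dehom_f_neq0 : dehom f != 0.
Proof. by rewrite -size_poly_eq0 size_dehom_f. Qed.

(** Modulo x and at y = 1 the form becomes a multiple of [dehom f] of degree below d, while
    [dehom f] has degree exactly d because [f] is monic in z. *)
Lemma yzform_indep n r h a : yzform n d a = x * r + h * f ->
  forall i, (i < d)%N -> a i = 0.
Proof.
move=> /(congr1 dehom); rewrite dehom_yzform rmorphD !rmorphM /= dehom_x mul0r add0r.
move=> e i id; suff : (\poly_(i < d) a i) = 0.
  by move/(congr1 (fun u : {poly k} => u`_i)); rewrite coef_poly id coef0.
rewrite e; have [->|h0] := eqVneq (dehom h) 0; first by rewrite mul0r.
exfalso; have := size_poly d a; rewrite e size_mul ?dehom_f_neq0 // size_dehom_f.
move: h0; rewrite -size_poly_gt0; case: (size _) => // s _.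
by rewrite addSn /= addnS ltnNge leq_addl.
Qed.

(** As [dehom f] is nonzero in a domain, [dehom h] vanishes, and on homogeneous polynomials [dehom]
    kills only multiples of x. *)
Lemma homog_dvd_x n h g : h \is n.-homog -> h * f = x * g ->
  exists r, h = x * r.
Proof.
move=> hh e; have [r _ eh] := homog_mod_x hh; exists r.
have : dehom h = 0.
  move/(congr1 dehom): e; rewrite !rmorphM /= dehom_x mul0r => /eqP.
  by rewrite mulf_eq0 (negPf dehom_f_neq0) orbF => /eqP.
rewrite eh rmorphD rmorphM /= dehom_x mul0r add0r dehom_yzform => p0.
rewrite [X in _ + X]big1 ?addr0 // => i _.
have := congr1 (fun u : {poly k} => u`_i) p0; rewrite coef_poly ltn_ord coef0 => ->.
by rewrite scale0r.
Qed.

(** By [homog_dvd_x] the cofactor of [f] is itself a multiple of x, which cancels. This regularity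
    of x allows dividing syzygies by x. *)
Lemma modf_x n g : g \is n.-homog -> modf (x * g) -> modf g.
Proof.
move=> hg [h e].
have xI : injective ( *%R (x : P)).
  by apply: mulfI; rewrite -msize_poly_eq0 msizeX.
have hxg := homog_XM o0 hg.
have [lt|le] := ltnP n.+1 d.
  have : x * g = x * 0 by rewrite mulr0 -(pihomog_dE hxg) e (pihomogM_lt _ f_homog).
  by move/xI => ->; exact: modf0.
have hxg' : x * g \is (n.+1 - d + d).-homog by rewrite subnK.
have e' := homog_dvd f_homog hxg' e.
have [r er] := homog_dvd_x (pihomogP _ _ _) (esym e').
by exists r; apply: xI; rewrite e' er mulrA.
Qed.

Lemma modf_pihomog n p : modf p -> modf (pihomog mdeg n p).
Proof.
case=> h ->; have [nd|dn] := ltnP n d.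
  by rewrite (pihomogM_lt _ f_homog) //; apply: modf0.
by exists (pihomog mdeg (n - d) h); rewrite -(pihomogM _ _ f_homog) subnK.
Qed.

Definition normal_form n p := exists r a h,
  [/\ r \is n.-1.-homog, h \is (n - d)%N.-homog & p = x * r + yzform n d a + h * f].

Lemma normal_formD n p g : normal_form n p -> normal_form n g -> normal_form n (p + g).
Proof.
move=> [r [a [h [hr hh ->]]]] [r' [a' [h' [hr' hh' ->]]]].
exists (r + r'), (fun i => a i + a' i), (h + h'); split; rewrite ?rpredD //.
by rewrite yzformD mulrDr mulrDl addrACA; congr (_ + _); rewrite addrACA.
Qed.

Lemma normal_formZ n s p : normal_form n p -> normal_form n (s *: p).
Proof.
move=> [r [a [h [hr hh ->]]]].
exists (s *: r), (fun i => s * a i), (s *: h); split; rewrite ?rpredZ //.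
by rewrite yzformZ -scalerAr -scalerAl !scalerDr.
Qed.

Lemma yzform0 n L : yzform n L (fun=> 0) = 0.
Proof. by rewrite /yzform big1 // => i _; rewrite scale0r. Qed.

Lemma normal_form_x n r : r \is n.-1.-homog -> normal_form n (x * r).
Proof.
by move=> hr; exists r, (fun=> 0), 0; rewrite yzform0 mul0r !addr0 rpred0.
Qed.

Lemma normal_form0 n : normal_form n 0.
Proof. by rewrite -(mulr0 (x : P)); apply: normal_form_x; apply: rpred0. Qed.

Lemma normal_form_sum n (I : finType) (F : I -> P) :
  (forall i, normal_form n (F i)) -> normal_form n (\sum_i F i).
Proof.
by move=> hF; elim/big_ind: _ => //; [apply: normal_form0|apply: normal_formD].
Qed.

(** This is division by [f] in z: for j >= d the multiple y^(n-j) z^(j-d) f expresses the monomial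
    through smaller powers of z and a multiple of x. *)
Lemma normal_form_yz n j : (d <= n.+1)%N -> (j <= n)%N ->
  normal_form n 'X_[mnm3 0 (n - j) j].
Proof.
move=> dn; elim/ltn_ind: j => j IH jn; have [jd|dj] := ltnP j d.
  exists 0, (fun i => (i == j)%:R), 0; rewrite !rpred0; split=> //.
  rewrite mulr0 mul0r add0r addr0 /yzform (bigD1 (Ordinal jd)) //= eqxx scale1r.
  rewrite big1 ?addr0 // => i ij.
  by rewrite (_ : (i == j :> nat) = false) ?scale0r //; apply: negbTE.
have [r hr ef] := homog_mod_x f_homog; set t := 'X_[mnm3 0 (n - j) (j - d)] : P.
set fa := (fun i => _) in ef.
have et i : (i <= d)%N -> t * 'X_[mnm3 0 (d - i) i] =
     'X_[mnm3 0 (n - (j - d + i)) (j - d + i)].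
  move=> id; rewrite -mpolyXD; congr 'X_[_]; apply/mnmP.
  by apply: ord3P; rewrite mnmDE !mnm3E //; lia.
have fad : fa d != 0 by rewrite /fa subnn.
have ht : t \is (n - d).-homog.
  by rewrite dhomogX /= mdeg3 !mnm3E; apply/eqP; lia.
have -> : 'X_[mnm3 0 (n - j) j] =
   (fa d)^-1 *: (t * f) + (- (fa d)^-1) *: (x * (t * r)) +
    (- (fa d)^-1) *: \sum_(i < d) fa i *: 'X_[mnm3 0 (n - (j - d + i)) (j - d + i)] :> P.
  have -> : \sum_(i < d) fa i *: 'X_[mnm3 0 (n - (j - d + i)) (j - d + i)] =
     t * yzform d d fa.
    rewrite mulr_sumr; apply: eq_bigr => i _.
    by rewrite -scalerAr et // ltnW.
  rewrite ef /yzform big_ord_recr /= -/(yzform d d fa) !mulrDr -scalerAr et // subnK //.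
  rewrite !scalerDr scalerA mulVf // scale1r !scaleNr mulrCA.
  set A := _ *: (x * _); set B := _ *: (t * _); set C := 'X_[_].
  by rewrite -[A + _ - A]addrAC subrr add0r [B + C]addrC addrK.
apply: normal_formD; first apply: normal_formD.
- apply: normal_formZ; exists 0, (fun=> 0), t; rewrite rpred0 ht yzform0; split=> //.
  by rewrite mulr0 !add0r.
- apply: normal_formZ; apply: normal_form_x.
  have -> : n.-1 = (n - d + d.-1)%N by lia.
  exact: dhomogM.
apply/normal_formZ/normal_form_sum => i; apply: normal_formZ.
have := ltn_ord i => ?; apply: IH; lia.
Qed.

Lemma normal_form_homog n p : (d <= n.+1)%N -> p \is n.-homog -> normal_form n p.
Proof.
move=> dn hp; have [r hr ->] := homog_mod_x hp.
apply/normal_formD; first exact: normal_form_x.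
by apply: normal_form_sum => i; apply/normal_formZ/normal_form_yz => //; rewrite -ltnS.
Qed.

Lemma homog_modxf n p r h : (0 < n)%N -> p \is n.-homog -> p = x * r + h * f ->
  exists r' h', r' \is n.-1.-homog /\ p = x * r' + h' * f.
Proof.
move=> n0 hp e.
have {}e : p = pihomog mdeg n (x * r) + pihomog mdeg n (h * f).
  by rewrite -pihomogD -e pihomog_dE.
have ex : pihomog mdeg n (x * r) = x * pihomog mdeg n.-1 r.
  have en : n = (n.-1 + 1)%N by lia.
  by rewrite mulrC {1}en pihomogM ?homogX // mulrC.
exists (pihomog mdeg n.-1 r).
have [lt|le] := ltnP n d.
  exists 0; rewrite pihomogP; split=> //.
  by rewrite {1}e ex (pihomogM_lt _ f_homog) // mul0r.
exists (pihomog mdeg (n - d) h); rewrite pihomogP; split=> //.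
by rewrite {1}e ex -{2}(subnK le) pihomogM.
Qed.

(* [xy_form n s]: s is a form of degree n in k[x,y]. *)
Fixpoint xy_form n (s : P) : Prop :=
  if n is n'.+1 then exists s' (c : k), xy_form n' s' /\ s = x * s' + c *: y ^+ n
  else exists c : k, s = c%:MP.

Lemma xy_form0 n : xy_form n 0.
Proof.
elim: n => [|n IH]; first by exists 0.
by exists 0, 0; rewrite mulr0 scale0r addr0.
Qed.

Lemma xy_formD n s t : xy_form n s -> xy_form n t -> xy_form n (s + t).
Proof.
elim: n s t => [|n IH] s t /=; first by case=> a -> [b ->]; exists (a + b); rewrite mpolyCD.
case=> s' [a [hs ->]] [t' [b [ht ->]]]; exists (s' + t'), (a + b).
by rewrite mulrDr scalerDl addrACA; split=> //; apply: IH.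
Qed.

Lemma xy_formZ n (c : k) s : xy_form n s -> xy_form n (c *: s).
Proof.
elim: n s => [|n IH] s /=; first by case=> a ->; exists (c * a); rewrite -mul_mpolyC mpolyCM.
case=> s' [a [hs ->]]; exists (c *: s'), (c * a).
by rewrite scalerDr -scalerAr scalerA; split=> //; apply: IH.
Qed.

Lemma xy_form_x n s : xy_form n s -> xy_form n.+1 (x * s).
Proof. by exists s, 0; rewrite scale0r addr0. Qed.

Lemma xy_form_y n s : xy_form n s -> xy_form n.+1 (y * s).
Proof.
elim: n s => [|n IH] s /=.
  by case=> c ->; exists 0, c; rewrite mulr0 add0r expr1 mulrC mul_mpolyC; split=> //; exists 0.
case=> s' [a [hs ->]]; exists (y * s'), a; split; first exact: IH.
by rewrite mulrDr mulrCA -scalerAr -exprS.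
Qed.

Lemma xy_formXn n (c : k) : xy_form n (c *: y ^+ n).
Proof.
case: n => [|n]; first by exists c; rewrite expr0 -mul_mpolyC mulr1.
by exists 0, c; rewrite mulr0 add0r; split=> //; apply: xy_form0.
Qed.

Lemma xy_formM1 n s t : xy_form n s -> xy_form 1 t -> xy_form n.+1 (s * t).
Proof.
move=> hs [_ [b [[a ->] ->]]]; rewrite expr1 mulrDr mulrCA -scalerAr [s * y]mulrC.
apply: xy_formD; last exact/xy_formZ/xy_form_y.
by rewrite [s * _]mulrC mul_mpolyC; apply/xy_form_x/xy_formZ.
Qed.

Lemma xy_form_sum n (I : finType) (F : I -> P) :
  (forall i, xy_form n (F i)) -> xy_form n (\sum_i F i).
Proof. by move=> hF; elim/big_ind: _ => //; [apply: xy_form0|apply: xy_formD]. Qed.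

Lemma xy_form_homog n s : xy_form n s -> s \is n.-homog.
Proof.
elim: n s => [|n IH] s /=.
  by case=> c ->; rewrite -[c%:MP]mulr1 mul_mpolyC rpredZ // dhomog1.
case=> s' [c [/IH hs ->]]; rewrite rpredD ?homog_XM // rpredZ //.
by rewrite mpolyXn dhomogX /= mdegMn mdeg1 mul1n.
Qed.

End ModF.

(** * The module of second syzygies *)

Section SyzygyModule.
Variables (k : fieldType) (r e : nat) (f : {mpoly k[3]}).
Local Notation d := e.*2.
Local Notation q := r.*2.+1.
Local Notation P := {mpoly k[3]}.
Local Notation modf := (modf f).
Implicit Types (p g h : P) (v w : 'rV[P]_3) (a b c : nat -> k).

Definition vmodf m (v : 'rV[P]_m) := forall l, modf (v 0 l).

Definition syzygy v := modf (theta q v).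

Lemma vmodfE m (v : 'rV[P]_m) : vmodf v <-> exists w : 'rV_m, v = f *: w.
Proof.
split=> [/fin_all_exists[w ew]|[w ->] l]; last by exists (w 0 l); rewrite mxE mulrC.
by exists (\row_l w l); apply/rowP => l; rewrite !mxE ew mulrC.
Qed.

Lemma vmodfD m (v w : 'rV[P]_m) : vmodf v -> vmodf w -> vmodf (v + w).
Proof. by move=> hv hw l; rewrite mxE; apply: modfD. Qed.

Lemma vmodfB m (v w : 'rV[P]_m) : vmodf v -> vmodf w -> vmodf (v - w).
Proof. by move=> hv hw l; rewrite !mxE; apply: modfB. Qed.

Lemma vmodfZ m (c : P) (v : 'rV[P]_m) : vmodf v -> vmodf (c *: v).
Proof. by move=> hv l; rewrite mxE; apply: modfMl. Qed.

Lemma vmodf_syzygy v : vmodf v -> syzygy v.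
Proof. by case/vmodfE=> w ->; rewrite /syzygy thetaZ mulrC; exists (theta q w). Qed.

Lemma syzygyB v w : syzygy v -> syzygy w -> syzygy (v - w).
Proof. by move=> hv hw; rewrite /syzygy thetaB; apply: modfB. Qed.

Lemma syzygy_mul m (t : 'rV[P]_m) (A : 'M[P]_(m, 3)) :
  (forall i, syzygy (row i A)) -> syzygy (t *m A).
Proof.
move=> hA; suff -> : t *m A = \sum_i t 0 i *: row i A.
  rewrite /syzygy; elim/big_ind: _ => [|u w|i _].
  - by rewrite theta0; apply: modf0.
  - by rewrite thetaD; apply: modfD.
  by rewrite thetaZ; apply/modfMl/hA.
by rewrite mulmx_sum_row.
Qed.

Lemma hrowB m n (v w : 'rV[P]_m) : hrow n v -> hrow n w -> hrow n (v - w).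
Proof. by move=> hv hw l; rewrite !mxE rpredB. Qed.

Lemma hrowZ m n n' (c : P) (v : 'rV[P]_m) : c \is n'.-homog -> hrow n v ->
  hrow (n' + n) (c *: v).
Proof. by move=> hc hv l; rewrite mxE dhomogM. Qed.

Lemma hrow_mul m m' n n' (v : 'rV[P]_m) (A : 'M[P]_(m, m')) : hrow n v ->
  (forall i j, A i j \is n'.-homog) -> hrow (n + n') (v *m A).
Proof. by move=> hv hA l; rewrite mxE; apply: rpred_sum => i _; rewrite dhomogM. Qed.

Hypotheses (e_gt0 : (0 < e)%N) (er : (e < r)%N).
Hypotheses (f_homog : f \is d.-homog) (f_monic : f@_(mnm3 0 0 d) != 0).
Hypothesis det_f : \det (mul_mx q (3 * r - e) (fun m => f@_m)) != 0.

Let d_gt0 : (0 < d)%N. Proof. by lia. Qed.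

Let f_neq0 : f != 0.
Proof. by apply: contraNneq f_monic => ->; rewrite mcoeff0. Qed.

(** Entries of degree r + e - 1 put the syzygy in degree N = 3r + e. If [theta q v] is h f, the
    reduced part g0 of h satisfies f g0 in (x^q,y^q,z^q), so the determinant forces g0 = 0; the rest
    is [theta_inj], as r + e - 1 < q. *)
Lemma syzygy_low v : hrow (r + e).-1 v -> syzygy v -> vmodf v.
Proof.
move=> hv [h0 e0].
have eN : ((r + e).-1 + q = (3 * r - e) + d)%N by lia.
have hT : theta q v \is ((3 * r - e) + d).-homog by rewrite -eN; apply: homog_theta.
have := homog_dvd f_homog hT e0; set h := pihomog _ _ _ => eh.
have hh : h \is (3 * r - e).-homog by apply: pihomogP.
have [g0 [w [eg hg0 rg0 hw]]] := theta_reduce q hh.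
have fg0 : f * g0 = theta q (v - f *: w).
  by rewrite thetaB thetaZ eh eg; ring.
have eN' : (3 * r - e + (3 * r + e) = 3 * q.-1)%N by lia.
have g00 : g0 = 0.
  apply: (mul_mx_inj _ eN' det_f hg0 rg0) => // m _ rm.
  by rewrite fg0 theta_reduced.
apply/vmodfE; exists w; apply/eqP; rewrite -subr_eq0; apply/eqP.
apply: (@theta_inj _ q (r + e).-1); rewrite -?fg0 ?g00 ?mulr0 //; first by lia.
apply: hrowB => //.
have -> : ((r + e).-1 = d + (3 * r - e - q))%N by lia.
exact: hrowZ.
Qed.

Definition in_xf p := exists u h : P, p = x * u + h * f.

Lemma in_xfD p g : in_xf p -> in_xf g -> in_xf (p + g).
Proof.
by case=> u [h ->] [u' [h' ->]]; exists (u + u'), (h + h'); rewrite mulrDr mulrDl addrACA.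
Qed.

Lemma in_xfMl (c : P) p : in_xf p -> in_xf (c * p).
Proof. by case=> u [h ->]; exists (c * u), (c * h); ring. Qed.

Lemma in_xf_x p : in_xf (x * p).
Proof. by exists p, 0; rewrite mul0r addr0. Qed.

Lemma in_xf_modf p : modf p -> in_xf p.
Proof. by case=> h ->; exists 0, h; rewrite mulr0 add0r. Qed.

Lemma in_xfB p g : in_xf p -> in_xf g -> in_xf (p - g).
Proof. by move=> hp hg; rewrite -[- g]mulN1r; apply: in_xfD => //; apply: in_xfMl. Qed.

(* Modulo x the condition on the three entries u0, u1, u2 is
   y^q u1 + z^q u2 = 0 in k[y,z]/(f); multiplication by y is bijective there in high
   degrees, so u0 and u2 are arbitrary and determine u1. *)
Lemma syzygy_gen a c : exists v, [/\ hrow (r + e) v, syzygy v,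
  exists s, v 0 o0 = yzform (r + e) d a + x * s &
  exists s, v 0 o2 = yzform (r + e) d c + x * s].
Proof.
have dM : (d <= (r + e).+1)%N by lia.
set u := yzform (r + e) d.
have hu b : u b \is (r + e).-homog by apply: yzform_homog.
have hp : - (u c * z ^+ q) \is (r + e + q).-homog.
  by rewrite rpredN dhomogM // mpolyXn dhomogX /= mdegMn mdeg1 mul1n.
(* The normal form in degree r + e + q is y^q times the form with the same coefficients in degree r
   + e; this gives the middle entry. *)
have [|s [b [h [hs hh ep]]]] := normal_form_homog d_gt0 f_homog f_monic _ hp; first by lia.
pose v0 : 'rV[P]_3 := \row_l if l == o0 then u a else if l == o1 then u b else u c.
have e0 : v0 0 o0 = u a by rewrite mxE eqxx.
have e1 : v0 0 o1 = u b by rewrite mxE.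
have e2 : v0 0 o2 = u c by rewrite mxE.
have thv0 : theta q v0 = x * (u a * x ^+ r.*2 - s) - h * f.
  rewrite /theta sum3 e0 e1 e2 [u b * _]mulrC yzform_mul //.
  have : u c * z ^+ q = - (x * s) - yzform (r + e + q) d b - h * f.
    by rewrite -[LHS]opprK ep !opprD.
  move=> ->; rewrite [(q + _)%N]addnC exprS.
  by ring.
have hN : u a * x ^+ r.*2 - s \is (3 * r + e).-homog.
  have eN : (3 * r + e = r + e + r.*2)%N by lia.
  apply: rpredB.
    by rewrite eN dhomogM // mpolyXn dhomogX /= mdegMn mdeg1 mul1n.
  by have <- : (r + e + q).-1 = (3 * r + e)%N by lia.
have eN' : (3 * r - e + (3 * r + e) = 3 * q.-1)%N by lia.
(* Modulo [f], the value of [theta] at [v0] is x times a form of degree 3r + e. Surjectivity writes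
   that form as f g plus the value of [theta] at [w], so subtracting [x *: w] corrects [v0]. *)
have [||g [w [hg hw ew]]] := mul_mx_surj _ eN' det_f f_homog _ hN => //; first by lia.
exists (v0 - x *: w); split.
- apply: hrowB; first by apply: ord3P; rewrite ?e0 ?e1 ?e2.
  have -> : (r + e = 1 + (3 * r + e - q))%N by lia.
  by apply: hrowZ => //; apply: homogX.
- rewrite /syzygy thetaB thetaZ thv0 ew.
  by exists (x * g - h); ring.
- by exists (- w 0 o0); rewrite !mxE eqxx mulrN.
- by exists (- w 0 o2); rewrite !mxE mulrN.
Qed.

(* With M = r+e, the j-th generator has, modulo x, first and last entries
   y^(M-j) z^j and 0 for j < d, and 0 and y^(M-j+d) z^(j-d) for j >= d. *)
Definition coef_first (j : 'I_(d + d)) : nat -> k := fun i => (i == j)%:R.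
Definition coef_last (j : 'I_(d + d)) : nat -> k := fun i => ((d + i)%N == j)%:R.

Lemma sum_coef_first (t : 'I_(d + d) -> k) n :
  \sum_j t j *: yzform n d (coef_first j) =
  yzform n d (fun i => \sum_j t j * coef_first j i).
Proof. by rewrite yzform_sum; apply: eq_bigr => j _; rewrite yzformZ. Qed.

Lemma sum_coef_last (t : 'I_(d + d) -> k) n :
  \sum_j t j *: yzform n d (coef_last j) =
  yzform n d (fun i => \sum_j t j * coef_last j i).
Proof. by rewrite yzform_sum; apply: eq_bigr => j _; rewrite yzformZ. Qed.

Lemma sum_coef_firstE (t : 'I_(d + d) -> k) (i : 'I_d) :
  \sum_j t j * coef_first j i = t (lshift d i).
Proof.
rewrite (bigD1 (lshift d i)) //= big1 ?addr0 => [|j /negPf ji].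
  by rewrite /coef_first eqxx mulr1.
by rewrite /coef_first eq_sym -[X in _ == X]/(nat_of_ord (lshift d i)) val_eqE ji mulr0.
Qed.

Lemma sum_coef_lastE (t : 'I_(d + d) -> k) (i : 'I_d) :
  \sum_j t j * coef_last j i = t (rshift d i).
Proof.
rewrite (bigD1 (rshift d i)) //= big1 ?addr0 => [|j /negPf ji].
  by rewrite /coef_last eqxx mulr1.
by rewrite /coef_last eq_sym -[X in _ == X]/(nat_of_ord (rshift d i)) val_eqE ji mulr0.
Qed.

Lemma eq_yzform n a b : (forall i : 'I_d, a i = b i) -> yzform n d a = yzform n d b.
Proof. by move=> ab; apply: eq_bigr => i _; rewrite ab. Qed.

Lemma syzygy_gens : exists G : 'M[P]_(d + d, 3),
  [/\ forall i j, G i j \is (r + e).-homog, forall i, syzygy (row i G),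
   forall i, exists s, G i o0 = yzform (r + e) d (coef_first i) + x * s &
   forall i, exists s, G i o2 = yzform (r + e) d (coef_last i) + x * s].
Proof.
have /fin_all_exists[G hG] := fun j => syzygy_gen (coef_first j) (coef_last j).
exists (\matrix_i G i); split=> i; have [hi zi fi li] := hG i.
- by move=> j; rewrite mxE.
- by rewrite rowK.
- by case: fi => s es; exists s; rewrite mxE es.
- by case: li => s es; exists s; rewrite mxE es.
Qed.

(** * Freeness of the syzygy module over k[x,y] *)

Section Generators.
Variable G : 'M[P]_(d + d, 3).
Hypotheses (G_homog : forall i j, G i j \is (r + e).-homog).
Hypotheses (G_syzygy : forall i, syzygy (row i G)).
Hypothesis G_first :
  forall i, exists s, G i o0 = yzform (r + e) d (coef_first i) + x * s.
Hypothesis G_last :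
  forall i, exists s, G i o2 = yzform (r + e) d (coef_last i) + x * s.

Definition yrow n (t : 'I_(d + d) -> k) : 'rV[P]_(d + d) := \row_j (t j *: y ^+ n).

Lemma yrowG_first n t : exists s,
  (yrow n t *m G) 0 o0 = yzform (n + (r + e)) d (fun i => \sum_j t j * coef_first j i) + x * s.
Proof.
have /fin_all_exists[s es] := G_first.
exists (\sum_j yrow n t 0 j * s j); rewrite mxE mulr_sumr -sum_coef_first -big_split.
apply: eq_bigr => j _ /=; rewrite es mulrDr [_ * (x * _)]mulrCA; congr (_ + _).
by rewrite mxE -scalerAl yzform_mul //; lia.
Qed.

Lemma yrowG_last n t : exists s,
  (yrow n t *m G) 0 o2 = yzform (n + (r + e)) d (fun i => \sum_j t j * coef_last j i) + x * s.
Proof.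
have /fin_all_exists[s es] := G_last.
exists (\sum_j yrow n t 0 j * s j); rewrite mxE mulr_sumr -sum_coef_last -big_split.
apply: eq_bigr => j _ /=; rewrite es mulrDr [_ * (x * _)]mulrCA; congr (_ + _).
by rewrite mxE -scalerAl yzform_mul //; lia.
Qed.

Lemma yrow_homog n t : hrow n (yrow n t).
Proof.
by move=> l; rewrite mxE rpredZ // mpolyXn dhomogX /= mdegMn mdeg1 mul1n.
Qed.

(** The generators times y^n adjust the first and last entries to zero modulo (x,f); the middle one
    follows, and what is left is divisible by x modulo [f]. *)
Lemma syzygy_reduce n v : hrow (n + (r + e)) v -> syzygy v ->
  exists t v' w, [/\ hrow (n + (r + e)).-1 v', syzygy v' &
    v = yrow n t *m G + x *: v' + f *: w].
Proof.
move=> hv zv; have dn : (d <= (n + (r + e)).+1)%N by lia.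
have [s0 [a [h0 [_ _ ev0]]]] := normal_form_homog d_gt0 f_homog f_monic dn (hv o0).
have [s2 [c [h2 [_ _ ev2]]]] := normal_form_homog d_gt0 f_homog f_monic dn (hv o2).
pose t (j : 'I_(d + d)) := match split j with inl i => a i | inr i => c i end.
set u := v - yrow n t *m G.
have hu : hrow (n + (r + e)) u.
  by apply: hrowB => //; apply: hrow_mul => //; apply: yrow_homog.
have zu : syzygy u by apply: syzygyB => //; apply: syzygy_mul.
have u0 : in_xf (u 0 o0).
  have [s es] := yrowG_first n t.
  rewrite !mxE -/((yrow n t *m G) 0 o0).
  have -> : (\sum_j yrow n t 0 j * G j o0) = (yrow n t *m G) 0 o0 by rewrite mxE.
  rewrite es ev0 (@eq_yzform _ (fun i => \sum_j t j * coef_first j i) a); last first.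
    by move=> i; rewrite sum_coef_firstE /t (unsplitK (inl i)).
  exists (s0 - s), h0; by ring.
have u2 : in_xf (u 0 o2).
  have [s es] := yrowG_last n t.
  rewrite !mxE.
  have -> : (\sum_j yrow n t 0 j * G j o2) = (yrow n t *m G) 0 o2 by rewrite mxE.
  rewrite es ev2 (@eq_yzform _ (fun i => \sum_j t j * coef_last j i) c); last first.
    by move=> i; rewrite sum_coef_lastE /t (unsplitK (inr i)).
  exists (s2 - s), h2; by ring.
(* The syzygy relation puts y^q u1 in (x,f); multiplication by y^q keeps the coefficients of the
   normal form, which are therefore zero. *)
have u1 : in_xf (u 0 o1).
  have [s1 [b [h1 [_ _ eu1]]]] := normal_form_homog d_gt0 f_homog f_monic dn (hu o1).
  have eb i : (i < d)%N -> b i = 0.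
    have : in_xf (y ^+ q * yzform (n + (r + e)) d b).
      have -> : yzform (n + (r + e)) d b = u 0 o1 - x * s1 - h1 * f.
        by rewrite eu1; ring.
      rewrite !mulrBr; apply: in_xfB; first apply: in_xfB.
      - move: (zu); rewrite /syzygy /theta sum3 => /in_xf_modf hs.
        have -> : y ^+ q * u 0 o1 = (u 0 o0 * x ^+ q + u 0 o1 * y ^+ q + u 0 o2 * z ^+ q)
            - x ^+ q * u 0 o0 - z ^+ q * u 0 o2.
          by ring.
        by apply: in_xfB; [apply: in_xfB => // |]; apply: in_xfMl.
      - by apply/in_xfMl/in_xf_x.
      by apply/in_xfMl/in_xf_modf; exists h1.
    rewrite yzform_mul // => -[s' [h' e']] id.
    exact: (yzform_indep f_homog f_monic e' id).
  rewrite eu1 (@eq_yzform _ _ (fun=> 0)) => [|i]; last exact: eb.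
  by rewrite yzform0 addr0; exists s1, h1.
have : forall l, exists v' h' : P, v' \is (n + (r + e)).-1.-homog /\ u 0 l = x * v' + h' * f.
  have M0 : (0 < n + (r + e))%N by lia.
  by apply: ord3P; [case: u0 | case: u1 | case: u2] => s [h eu];
    apply: homog_modxf d_gt0 f_homog f_monic _ _ _ _ M0 (hu _) eu.
case/fin_all_exists => v' /fin_all_exists[w ew].
have eu : u = x *: (\row_l v' l) + f *: (\row_l w l).
  by apply/rowP => l; rewrite (ew l).2 !mxE [f * _]mulrC.
exists t, (\row_l v' l), (\row_l w l); split.
- by move=> l; rewrite mxE; case: (ew l).
- have hv' : hrow (n + (r + e)).-1 (\row_l v' l) by move=> l; rewrite mxE; case: (ew l).
  (* The quotient by x is again a syzygy, because x is regular modulo [f]. *)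
  apply: (modf_x f_homog f_monic (homog_theta q hv')).
  move: zu; rewrite /syzygy eu thetaD !thetaZ => zu.
  rewrite -[x * _](addrK (f * theta q (\row_l w l))); apply: modfB => //.
  by exists (theta q (\row_l w l)); rewrite mulrC.
by rewrite -addrA -eu /u addrC subrK.
Qed.

(** Each reduction leaves x times a syzygy one degree lower, until [syzygy_low] makes it vanish. The
    coefficients accumulate as forms in x and y. *)
Lemma syzygy_span n v : hrow (n + (r + e)) v -> syzygy v ->
  exists s : 'rV[P]_(d + d), (forall j, xy_form n (s 0 j)) /\ vmodf (v - s *m G).
Proof.
elim: n v => [|n IH] v hv zv; have [t [v' [w [hv' zv' ev]]]] := syzygy_reduce hv zv.
  exists (yrow 0 t); split; first by move=> j; rewrite mxE; apply: xy_formXn.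
  rewrite ev -[_ + _ + f *: w]addrA addrC addrK; apply: vmodfD; last by apply/vmodfE; exists w.
  by apply/vmodfZ/syzygy_low.
have [s [hs es]] := IH v' hv' zv'.
exists (yrow n.+1 t + x *: s); split.
  move=> j; rewrite 2!mxE [(x *: s) _ _]mxE.
  by apply: xy_formD; [apply: xy_formXn|apply: xy_form_x].
rewrite ev mulmxDl -scalemxAl.
have -> : yrow n.+1 t *m G + x *: v' + f *: w - (yrow n.+1 t *m G + x *: (s *m G)) =
  x *: (v' - s *m G) + f *: w.
  by rewrite -[_ + _ + f *: w]addrA [_ + (_ + f *: w)]addrC addrKA addrAC scalerBr.
by apply: vmodfD; [exact: vmodfZ | apply/vmodfE; exists w].
Qed.

Lemma yrow_indep n t p0 p2 : modf ((yrow n t *m G) 0 o0 + x * p0) ->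
  modf ((yrow n t *m G) 0 o2 + x * p2) -> forall j, t j = 0.
Proof.
have [s0 ->] := yrowG_first n t; have [s2 ->] := yrowG_last n t.
move=> [h0 e0] [h2 e2] j.
have {}e0 : yzform (n + (r + e)) d (fun i => \sum_j t j * coef_first j i) =
     x * (- s0 - p0) + h0 * f.
  by rewrite -e0; ring.
have {}e2 : yzform (n + (r + e)) d (fun i => \sum_j t j * coef_last j i) =
     x * (- s2 - p2) + h2 * f.
  by rewrite -e2; ring.
case: (splitP j) => i ei.
  have <- : lshift d i = j by apply: val_inj.
  by rewrite -sum_coef_firstE (yzform_indep f_homog f_monic e0).
have <- : rshift d i = j by apply: val_inj.
by rewrite -sum_coef_lastE (yzform_indep f_homog f_monic e2).
Qed.

(** The first and last entries modulo (x,f) show that the coefficients of y^n vanish ([yrow_indep]);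
    then x cancels and the degree drops. *)
Lemma G_indep n (s : 'rV[P]_(d + d)) :
  (forall j, xy_form n (s 0 j)) -> vmodf (s *m G) -> s = 0.
Proof.
elim: n s => [|n IH] s.
  case/fin_all_exists => t et h.
  have es : s = yrow 0 t.
    by apply/rowP => j; rewrite !mxE et expr0 -mul_mpolyC mulr1.
  have t0 := @yrow_indep 0 t 0 0; rewrite -es mulr0 !addr0 in t0.
  by rewrite es; apply/rowP => j; rewrite !mxE (t0 (h _) (h _)) scale0r.
case/fin_all_exists => s' /fin_all_exists[t ht] h.
have es : s = yrow n.+1 t + x *: (\row_j s' j).
  by apply/rowP => j; rewrite !mxE (ht j).2 addrC.
have eG l : (s *m G) 0 l = (yrow n.+1 t *m G) 0 l + x * ((\row_j s' j) *m G) 0 l.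
  by rewrite es mulmxDl -scalemxAl mxE; congr (_ + _); rewrite mxE.
have t0 j : t j = 0.
  have h0 := h o0; have h2 := h o2; rewrite !eG in h0 h2.
  exact: (yrow_indep h0 h2).
have y0 : yrow n.+1 t = 0 by apply/rowP => j; rewrite !mxE t0 scale0r.
have s'0 : \row_j s' j = 0.
  apply: IH => [j|l]; first by rewrite mxE; case: (ht j).
  apply: (modf_x f_homog f_monic (n := n + (r + e))).
    apply: hrow_mul => // j; rewrite mxE.
    by apply: xy_form_homog; case: (ht j).
  by have := h l; rewrite eG y0 mul0mx [(0 : 'M_(_, _)) _ _]mxE add0r.
by rewrite es y0 s'0 scaler0 addr0.
Qed.

(** z times a generator is a syzygy one degree above the generators, so [syzygy_span] expresses it
    with linear forms in x and y. *)
Lemma z_action : exists A : 'M[P]_(d + d),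
  (forall i j, xy_form 1 (A i j)) /\ forall i, vmodf (row i ((z%:M - A) *m G)).
Proof.
have : forall i, exists s : 'rV[P]_(d + d),
    (forall j, xy_form 1 (s 0 j)) /\ vmodf (z *: row i G - s *m G).
  move=> i; apply: (@syzygy_span 1).
    by apply: hrowZ; [apply: homogX | move=> j; rewrite mxE].
  by rewrite /syzygy thetaZ; apply/modfMl/G_syzygy.
case/fin_all_exists=> A hA; exists (\matrix_i A i); split=> i.
  by move=> j; rewrite mxE; case: (hA i).
rewrite mulmxBl mul_scalar_mx linearB linearZ /= row_mul rowK.
exact: (hA i).2.
Qed.

End Generators.


(** Multiplication by powers of x raises the degree to that of [syzygy_low], and x is regular modulo
    [f]. *)
Lemma syzygy_below n v : (n < r + e)%N -> hrow n v -> syzygy v -> vmodf v.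
Proof.
move=> nM; have [m em] : exists m, (n + m = (r + e).-1)%N.
  by exists ((r + e).-1 - n)%N; lia.
elim: m n em {nM} v => [|m IH] n em v hv zv.
  by apply: syzygy_low => //; rewrite -em addn0.
have xv : vmodf (x *: v).
  apply: (IH n.+1); first by rewrite addSnnS.
    by move=> l; rewrite mxE; apply: homog_XM.
  by rewrite /syzygy thetaZ; apply: modfMl.
by move=> l; apply: (modf_x f_homog f_monic (hv l)); have := xv l; rewrite mxE.
Qed.

Definition rcomp m n (v : 'rV[P]_m) : 'rV[P]_m := map_mx (pihomog mdeg n) v.

Lemma rcomp_homog m n (v : 'rV[P]_m) : hrow n (rcomp n v).
Proof. by move=> l; rewrite mxE pihomogP. Qed.

Lemma rcomp_sum m (v : 'rV[P]_m) : exists K, v = \sum_(n < K) rcomp n v.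
Proof.
exists (\sum_l msize (v ord0 l))%N; apply/rowP => l; rewrite summxE.
rewrite {1}(@pihomog_partitionE _ _ mdeg (\sum_l msize (v ord0 l)) (v 0 l)).
  by apply: eq_bigr => n _; rewrite mxE.
by rewrite (bigD1 l) //= leq_addr.
Qed.

Lemma vmodf_rcomp m n (v : 'rV[P]_m) : vmodf v -> vmodf (rcomp n v).
Proof. by move=> hv l; rewrite mxE; apply: (modf_pihomog f_homog). Qed.

Lemma syzygy_rcomp n v : syzygy v -> syzygy (rcomp n v).
Proof.
move=> /(@modf_pihomog _ _ _ f_homog (n + q)); rewrite /syzygy /theta raddf_sum.
congr modf; apply: eq_bigr => l _; rewrite mxE /= pihomogM //.
by rewrite mpolyXn dhomogX /= mdegMn mdeg1 mul1n.
Qed.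

Lemma rcomp_mul m m' n n' (v : 'rV[P]_m) (A : 'M[P]_(m, m')) :
  (forall i j, A i j \is n'.-homog) -> rcomp n v *m A = rcomp (n + n') (v *m A).
Proof.
move=> hA; apply/rowP => l; rewrite !mxE raddf_sum; apply: eq_bigr => i _.
by rewrite mxE /= pihomogM.
Qed.

(** Homogeneous components reduce generation and relations to the graded statements above; the
    factorization of [f] then follows from the relations. *)
Lemma syzygy_presentation :
  exists (G : 'M[P]_(d + d, 3)) (phi psi : 'M[P]_(d + d)),
  [/\ forall i j, G i j \is (r + e).-homog,
      (forall i j, phi i j \is 1.-homog) /\ (forall i j, psi i j \is d.-1.-homog),
      forall v, syzygy v <-> exists t, vmodf (v - t *m G),
      forall t : 'rV_(d + d), vmodf (t *m G) <-> exists w : 'rV_(d + d), t = w *m phi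
    & psi *m phi = f%:M /\ phi *m psi = f%:M].
Proof.
have [G [G_homog G_syzygy G_first G_last]] := syzygy_gens.
have [A [hA zA]] := z_action G_homog G_syzygy G_first G_last.
pose phi := z%:M - A; exists G, phi.
have vphi (w : 'rV_(d + d)) : vmodf (w *m phi *m G).
  move=> l; rewrite -mulmxA mxE; apply: modf_sum => i; apply: modfMl.
  by have := zA i l; rewrite mxE.
have phi_homog i j : phi i j \is 1.-homog.
  rewrite !mxE rpredB ?rpredMn ?homogX //.
  exact: xy_form_homog (hA i j).
have span v : syzygy v <-> exists t, vmodf (v - t *m G).
  split=> [zv|[t ht]]; last first.
    rewrite -[v](subrK (t *m G)); rewrite /syzygy thetaD.
    by apply: modfD; [apply: vmodf_syzygy | apply: syzygy_mul].
  have [K eK] := rcomp_sum v.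
  have /fin_all_exists[t ht] : forall n : 'I_K, exists t, vmodf (rcomp n v - t *m G).
    move=> n; have hn := rcomp_homog n v; have zn := syzygy_rcomp n zv.
    have [lt|le] := ltnP n (r + e).
      by exists 0; rewrite mul0mx subr0; apply: syzygy_below lt hn zn.
    have [|t [_ ht]] := @syzygy_span _ G_homog G_syzygy G_first G_last (n - (r + e)) _ _ zn.
      by rewrite subnK.
    by exists t.
  exists (\sum_n t n); rewrite {1}eK mulmx_suml -sumrB => l; rewrite summxE.
  by apply: modf_sum => n; apply: ht.
(* Since z s = s phi + s A, every occurrence of z is traded for the linear forms of [A] modulo the
   rows of [phi]; freeness over k[x,y] then determines the kernel. *)
have reduce n (t : 'rV_(d + d)) : hrow n t -> exists w s : 'rV_(d + d),
    t = w *m phi + s /\ forall j, xy_form n (s 0 j).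
  elim: n t => [|n IH] t ht.
    exists 0, t; rewrite mul0mx add0r; split=> // j.
    exists (t 0 j)@_0%MM; apply/mpolyP => m; rewrite mcoeffC.
    have [->|m0] := eqVneq m 0%MM; first by rewrite mulr1.
    by rewrite mulr0 (dhomog_nemf_coeff (ht j)) //= mdeg_eq0.
  have /fin_all_exists[t0 /fin_all_exists[t1 /fin_all_exists[t2 et]]] :=
    fun j => homog_decomp3 (ht j).
  have [|w0 [s0 [e0 h0]]] := IH (\row_j t0 j); first by move=> j; rewrite mxE; case: (et j).
  have [|w1 [s1 [e1 h1]]] := IH (\row_j t1 j); first by move=> j; rewrite mxE; case: (et j).
  have [|w2 [s2 [e2 h2]]] := IH (\row_j t2 j); first by move=> j; rewrite mxE; case: (et j).
  exists (x *: w0 + y *: w1 + z *: w2 + s2), (x *: s0 + y *: s1 + s2 *m A); split.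
    have -> : t = x *: (\row_j t0 j) + y *: (\row_j t1 j) + z *: (\row_j t2 j).
      by apply/rowP => j; rewrite !mxE; case: (et j).
    rewrite e0 e1 e2 !mulmxDl -!scalemxAl.
    have -> : z *: (w2 *m phi + s2) = z *: (w2 *m phi) + (s2 *m phi + s2 *m A).
      by rewrite scalerDr; congr (_ + _); rewrite /phi mulmxBr addrNK mul_mx_scalar.
    rewrite [x *: (_ + _)]scalerDr [y *: (_ + _)]scalerDr !addrA.
    by rewrite [LHS](ACl (1*3*5*6*2*4*7)).
  move=> j; rewrite !mxE; apply: xy_formD; first apply: xy_formD.
  - exact: xy_form_x.
  - exact: xy_form_y.
  by apply: xy_form_sum => i; apply: xy_formM1.
have ker (t : 'rV_(d + d)) : vmodf (t *m G) <-> exists w : 'rV_(d + d), t = w *m phi.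
  split=> [ht|[w ->]]; last exact: vphi.
  have [K eK] := rcomp_sum t.
  have /fin_all_exists[w hw] : forall n : 'I_K, exists w : 'rV_(d + d), rcomp n t = w *m phi.
    move=> n; have [w [s [es hs]]] := reduce n _ (rcomp_homog n t).
    exists w; rewrite es (G_indep G_homog G_first G_last hs) ?addr0 //.
    have -> : s *m G = rcomp n t *m G - w *m phi *m G.
      by rewrite es mulmxDl addrAC subrr add0r.
    by apply: vmodfB => //; rewrite (rcomp_mul _ _ G_homog); apply: vmodf_rcomp.
  by exists (\sum_n w n); rewrite eK mulmx_suml; apply: eq_bigr => n _; apply: hw.
(* The rows of [f%:M] are relations modulo [f], hence combinations of the rows of [phi]. *)
have [psi0 e0] : exists psi0 : 'M_(d + d), f%:M = psi0 *m phi.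
  have /fin_all_exists[w hw] : forall i : 'I_(d + d),
      exists w : 'rV_(d + d), row i (f%:M) = w *m phi.
    move=> i; apply/ker/vmodfE; exists (row i G).
    by rewrite -row_mul mul_scalar_mx linearZ.
  by exists (\matrix_i w i); apply/row_matrixP => i; rewrite row_mul rowK.
pose psi : 'M_(d + d) := map_mx (pihomog mdeg d.-1) psi0.
have e1 : psi *m phi = f%:M.
  apply/matrixP => i j; rewrite mxE.
  have -> : (f%:M : 'M_(d + d)) i j = pihomog mdeg d ((f%:M : 'M_(d + d)) i j).
    by rewrite pihomog_dE // mxE rpredMn.
  rewrite e0 mxE raddf_sum; apply: eq_bigr => l _; rewrite mxE.
  rewrite -(pihomogM _ _ (phi_homog l j)) /=; congr (pihomog mdeg _ _); lia.
exists psi; split=> //.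
  by split=> // i j; rewrite mxE pihomogP.
split=> //.
(* A nonzero determinant lets [phi] be cancelled, which gives the product in the other order. *)
have dphi : \det phi != 0.
  have : \det (psi *m phi) != 0 by rewrite e1 det_scalar expf_neq0.
  by rewrite det_mulmx mulf_eq0 => /norP[].
apply/eqP; rewrite -subr_eq0; apply/eqP; set X := _ - _.
have X0 : X *m phi = 0.
  by rewrite mulmxBl -mulmxA e1 mul_mx_scalar mul_scalar_mx subrr.
have : X *m phi *m \adj phi = 0 by rewrite X0 mul0mx.
rewrite -mulmxA mul_mx_adj mul_mx_scalar => dX; apply/matrixP => i j.
have /eqP : (\det phi *: X) i j = 0 by rewrite dX mxE.
by rewrite mxE mulf_eq0 (negPf dphi) /= => /eqP ->; rewrite mxE.
Qed.

End SyzygyModule.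

(** * The resolution over the hypersurface *)

Local Open Scope quotient_scope.

Section HypersurfaceGrading.
Variables (k : fieldType) (f : {mpoly k[3]}).
Local Notation P := {mpoly k[3]}.
Local Notation R := (hypersurface f).

Definition hyp_pi (g : P) : R := \pi_R g.

Fact hyp_pi_is_zmod_morphism : zmod_morphism hyp_pi.
Proof. exact: raddfB. Qed.

HB.instance Definition _ :=
  GRing.isZmodMorphism.Build P R hyp_pi hyp_pi_is_zmod_morphism.

Fact hyp_pi_is_monoid_morphism : monoid_morphism hyp_pi.
Proof. by split; [exact: hyp_pi1 | exact: hyp_piM]. Qed.

HB.instance Definition _ :=
  GRing.isMonoidMorphism.Build P R hyp_pi hyp_pi_is_monoid_morphism.

Lemma hyp_pi_eq0 g : hyp_pi g = 0 <-> modf f g.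
Proof.
rewrite -(raddf0 hyp_pi) /hyp_pi hypersurface_eqP.
by split=> -[h]; rewrite ?subr0 => e; exists h; rewrite ?subr0.
Qed.

Lemma hyp_pi_repr (r : R) : hyp_pi (repr r) = r.
Proof. exact: reprK. Qed.

Lemma repr_hyp_pi g : modf f (repr (hyp_pi g) - g).
Proof. by apply/hyp_pi_eq0; rewrite rmorphB /= hyp_pi_repr subrr. Qed.

Definition lift_row n (v : 'rV[R]_n) : 'rV[P]_n := map_mx repr v.

Lemma lift_rowK n (v : 'rV[R]_n) : map_mx hyp_pi (lift_row v) = v.
Proof. by apply/rowP => l; rewrite !mxE hyp_pi_repr. Qed.

Lemma map_hyp_pi_eq0 n (v : 'rV[P]_n) : map_mx hyp_pi v = 0 <-> vmodf f v.
Proof.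
split=> [/rowP h l|h]; first by apply/hyp_pi_eq0; have := h l; rewrite !mxE.
by apply/rowP => l; rewrite !mxE; apply/hyp_pi_eq0/h.
Qed.

Variable d : nat.
Hypotheses (d_gt0 : (0 < d)%N) (f_homog : f \is d.-homog).

(** Taken on a representative; homogeneity of [f] makes the result independent of that choice. *)
Definition hyp_comp (n : int) (r : R) : R :=
  if n is Posz m then hyp_pi (pihomog mdeg m (repr r)) else 0.

Lemma hyp_comp_pi m g : hyp_comp (Posz m) (hyp_pi g) = hyp_pi (pihomog mdeg m g).
Proof.
apply/eqP; rewrite -subr_eq0 /= -rmorphB -raddfB; apply/eqP/hyp_pi_eq0.
by apply: (modf_pihomog f_homog); apply: repr_hyp_pi.
Qed.

Lemma hyp_compD n r s : hyp_comp n (r + s) = hyp_comp n r + hyp_comp n s.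
Proof.
case: n => m /=; last by rewrite addr0.
rewrite -{1}(hyp_pi_repr r) -{1}(hyp_pi_repr s) -rmorphD.
by have /= -> := hyp_comp_pi m (repr r + repr s); rewrite !raddfD.
Qed.

Lemma hyp_comp_deg n r : hyp_homog n (hyp_comp n r).
Proof. by case: n => m //=; exists (pihomog mdeg m (repr r)); rewrite ?pihomogP. Qed.

Lemma hyp_comp_id n r : hyp_homog n r -> hyp_comp n r = r.
Proof.
case: n => m => [[g hg ->]|-> //]; rewrite -/(hyp_pi g) hyp_comp_pi.
by rewrite pihomog_dE.
Qed.

Lemma hyp_compM n m r s : hyp_homog m s ->
  hyp_comp n (r * s) = hyp_comp (n - m) r * s.
Proof.
case: m => m; last first.
  move=> ->; rewrite !mulr0 hyp_comp_id //.
  by case: n => //= n; exists 0; rewrite ?rpred0 ?raddf0.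
case=> h hh ->; rewrite -/(hyp_pi h) -[r]hyp_pi_repr.
case: n => n; last first.
  have [j ->] : exists j, Negz n - m%:Z = Negz j by exists (n + m)%N; lia.
  by rewrite /= mul0r.
rewrite -rmorphM hyp_comp_pi; have [nm|mn] := ltnP n m.
  have [j ->] : exists j, n%:Z - m%:Z = Negz j by exists (m - n).-1; lia.
  by rewrite (pihomogM_lt _ hh) // raddf0 mul0r.
have -> : n%:Z - m%:Z = (n - m)%N by lia.
by rewrite hyp_comp_pi -rmorphM -(pihomogM _ _ hh) subnK.
Qed.

Let f0 : f@_0%MM = 0.
Proof. by rewrite (dhomog_nemf_coeff f_homog) //= mdeg0 eq_sym -lt0n. Qed.

Lemma hyp_residue_pi g : hyp_residue (hyp_pi g) = g@_0%MM.
Proof. exact: hyp_residueE. Qed.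

Fact hyp_residue_is_zmod_morphism : zmod_morphism (@hyp_residue k f).
Proof.
move=> r s; rewrite -{1}(hyp_pi_repr r) -{1}(hyp_pi_repr s) -rmorphB /= hyp_residue_pi.
by rewrite mcoeffB.
Qed.

Fact hyp_residue_is_monoid_morphism : monoid_morphism (@hyp_residue k f).
Proof.
split=> [|r s]; first by rewrite -(rmorph1 hyp_pi) /= hyp_residue_pi mcoeff1 eqxx.
rewrite -{1}(hyp_pi_repr r) -{1}(hyp_pi_repr s) -rmorphM /= hyp_residue_pi.
by rewrite [_@_0]rmorphM.
Qed.

(** Compatibility with the ring operations rests on the vanishing constant term of [f], so the
    morphism is packed inside a proof. *)
Lemma hyp_residue_rmorphism :
  exists eps : {rmorphism R -> k}, hyp_residue (f := f) = eps.
Proof.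
pose a := GRing.isZmodMorphism.Build R k _ hyp_residue_is_zmod_morphism.
pose m := GRing.isMonoidMorphism.Build R k _ hyp_residue_is_monoid_morphism.
pose e : {rmorphism R -> k} := HB.pack (@hyp_residue k f) a m.
by exists e.
Qed.

Lemma hyp_residue_deg n (r : R) : hyp_homog n r -> n != 0 -> hyp_residue r = 0.
Proof.
case: n => n /=.
  case=> g hg -> n0; rewrite -/(hyp_pi g) hyp_residue_pi (dhomog_nemf_coeff hg) //=.
  by rewrite mdeg0 eq_sym.
by move=> -> _; rewrite -(raddf0 hyp_pi) /= hyp_residue_pi mcoeff0.
Qed.

Section FrobeniusIdeal.
Variable q : nat.

Lemma frobenius_powerD (r s : R) :
  frobenius_power q r -> frobenius_power q s -> frobenius_power q (r + s).
Proof.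
case=> a -> [b ->]; exists (fun l => a l + b l).
by rewrite -big_split; apply: eq_bigr => l _; rewrite mulrDl.
Qed.

Lemma frobenius_powerM (r s : R) : frobenius_power q s -> frobenius_power q (r * s).
Proof.
case=> a ->; exists (fun l => r * a l).
by rewrite mulr_sumr; apply: eq_bigr => l _; rewrite mulrA.
Qed.

Lemma hyp_homogXn l : hyp_homog q%:Z ((\pi_R 'X_l : R) ^+ q).
Proof.
exists ('X_l ^+ q); first by rewrite mpolyXn dhomogX /= mdegMn mdeg1 mul1n.
exact: esym (rmorphXn hyp_pi q _).
Qed.

Lemma frobenius_power_comp n (r : R) :
  frobenius_power q r -> frobenius_power q (hyp_comp n r).
Proof.
case=> a ->; exists (fun l => hyp_comp (n - q%:Z) (a l)).
rewrite !sum3 !hyp_compD.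
by rewrite !(hyp_compM _ _ (hyp_homogXn _)).
Qed.

End FrobeniusIdeal.

Lemma betti_frobenius_power_resolution q K i j :
  graded_resolution (@hyp_homog k f) (frobenius_power q) K ->
  betti_frobenius_power f q i j = homology_dim (@hyp_residue k f) K i j.
Proof.
have [eps eeps] := hyp_residue_rmorphism; rewrite /betti_frobenius_power eeps.
move=> resK; apply: graded_betti_resolution resK.
- exact: hyp_compD.
- exact: hyp_comp_deg.
- exact: hyp_comp_id.
- exact: hyp_compM.
- by rewrite -eeps; apply: hyp_residue_deg.
- exact: frobenius_powerD.
- exact: frobenius_powerM.
- exact: frobenius_power_comp.
Qed.

(** Entries between generators of different degrees have residue 0, so the differentials around F_i
    vanish over [k] and the whole strand is homology. *)
Lemma minimal_homology_dim (K : free_complex R) i j :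
  (forall i a b, hyp_homog (gdeg (i := i.+1) a - gdeg (i := i) b) (dif K i a b)) ->
  (forall i' (a : 'I_(rk K i'.+1)) (b : 'I_(rk K i')),
      (0 < i')%N -> gdeg a != gdeg b) ->
  (2 <= i)%N -> homology_dim (@hyp_residue k f) K i j = \rank (strand k K i j).
Proof.
move=> hK gK; have dif0 i' : (0 < i')%N -> residue_dif (@hyp_residue k f) K i' = 0.
  move=> i0; apply/matrixP => a b; rewrite !mxE.
  by apply: hyp_residue_deg (hK i' a b) _; rewrite subr_eq0 gK.
case: i => [|[|i]] // _; rewrite /homology_dim /boundaries dif0 // mulmx0 mxrank0 subn0.
rewrite /cycles dif0 // (eqmxP _ : (kermx 0 :&: strand k K i.+2 j :=: strand k K i.+2 j)%MS) //.
by apply/eqmxP/capmx_idPr; rewrite sub_kermx mulmx0.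
Qed.

End HypersurfaceGrading.

(** On lifts, v A = f w gives f v = v A B = f w B, and [f] cancels in the polynomial ring. *)
Lemma matrix_factorization_exact (k : fieldType) (f : {mpoly k[3]}) n
    (A B : 'M[{mpoly k[3]}]_n) (v : 'rV[hypersurface f]_n) :
  f != 0 -> A *m B = f%:M -> B *m A = f%:M ->
  v *m map_mx (@hyp_pi k f) A = 0 <-> exists w, v = w *m map_mx (@hyp_pi k f) B.
Proof.
move=> f0 AB BA; split=> [|[w ->]]; last first.
  have f_0 : hyp_pi f f = 0 by apply/hyp_pi_eq0/modf_refl.
  by rewrite -mulmxA -map_mxM BA map_scalar_mx /= f_0 mul_mx_scalar scale0r.
rewrite -{1}(lift_rowK v) -map_mxM => /map_hyp_pi_eq0/vmodfE[w e].
exists (map_mx (@hyp_pi k f) w); rewrite -{1}(lift_rowK v) -map_mxM; congr map_mx.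
have : f *: (lift_row v - w *m B) = 0.
  by rewrite scalerBr scalemxAl -e -mulmxA AB mul_mx_scalar subrr.
move=> /rowP h; apply/rowP => l; have /eqP := h l; rewrite !mxE mulf_eq0 (negPf f0) /=.
by rewrite subr_eq0 => /eqP.
Qed.

(** * The explicit resolution, periodic from degree 2 on *)

Section Resolution.
Variables (k : fieldType) (r e : nat) (f : {mpoly k[3]}).
Local Notation d := e.*2.
Local Notation q := r.*2.+1.
Local Notation R := (hypersurface f).
Local Notation piM := (map_mx (@hyp_pi k f)).

Definition res_rk (i : nat) : nat :=
  match i with 0 => 1 | 1 => 3 | _ => d + d end.

(** F_2 is generated in degree N + 1 = 3r + e + 1; from there [phi] adds 1 and [psi] adds d - 1,
    alternately. *)
Definition res_deg (i : nat) : nat :=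
  match i with
  | 0 => 0
  | 1 => q
  | i'.+2 => 3 * r + e + 1 + i'./2 * d + odd i'
  end.

Variables (G : 'M[{mpoly k[3]}]_(d + d, 3)) (phi psi : 'M[{mpoly k[3]}]_(d + d)).

Definition res_dif (i : nat) : 'M[R]_(res_rk i.+1, res_rk i) :=
  match i with
  | 0 => \matrix_(l < 3, _ < 1) hyp_pi f 'X_l ^+ q
  | 1 => piM G
  | i'.+2 => if odd i' then piM psi else piM phi
  end.

Definition res_complex : free_complex R :=
  @FreeComplex R res_rk (fun i _ => (res_deg i)%:Z) res_dif (const_mx 1).

Hypotheses (e_gt0 : (0 < e)%N) (er : (e < r)%N) (f_neq0 : f != 0).
Hypothesis G_homog : forall i j, G i j \is (r + e).-homog.
Hypothesis phi_homog : forall i j, phi i j \is 1.-homog.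
Hypothesis psi_homog : forall i j, psi i j \is d.-1.-homog.
Hypothesis G_span :
  forall v, syzygy r f v <-> exists t, vmodf f (v - t *m G).
Hypothesis G_ker : forall t : 'rV_(d + d),
  vmodf f (t *m G) <-> exists w : 'rV_(d + d), t = w *m phi.
Hypotheses (psiphi : psi *m phi = f%:M) (phipsi : phi *m psi = f%:M).

Lemma hyp_homog_pi n m g : g \is n.-homog -> m = n%:Z -> hyp_homog m (hyp_pi f g).
Proof. by move=> hg ->; exists g. Qed.

Lemma res_complex_homog i a b :
  hyp_homog
    (gdeg (f := res_complex) (i := i.+1) a - gdeg (f := res_complex) (i := i) b)
    (dif res_complex i a b).
Proof.
rewrite /gdeg /=; case: i a b => [|[|i]] a b /=.
- rewrite mxE -rmorphXn /=; exists ('X_a ^+ q) => //; rewrite addn0.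
  by rewrite mpolyXn dhomogX /= mdegMn mdeg1 mul1n.
- by rewrite mxE; apply: hyp_homog_pi (G_homog _ _) _; lia.
rewrite uphalf_half; case: (odd i); rewrite mxE ?mulnDl.
  by apply: hyp_homog_pi (psi_homog _ _) _; lia.
by apply: hyp_homog_pi (phi_homog _ _) _; lia.
Qed.

Lemma res_complex_minimal i (a : 'I_(rk res_complex i.+1)) (b : 'I_(rk res_complex i)) :
  (0 < i)%N -> gdeg a != gdeg b.
Proof.
by case: i a b => [|[|i]] a b //= _; apply/eqP; rewrite /gdeg /= ?uphalf_half; try case: (odd i); lia.
Qed.

(** Exactness at F_1 is [G_span], at F_2 it is [G_ker], and beyond that it is exactness of the
    matrix factorization. *)
Lemma res_complex_resolution :
  graded_resolution (@hyp_homog k f) (frobenius_power q) res_complex.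
Proof.
have theta_pi v : (map_mx (@hyp_pi k f) v *m res_dif 0) 0 0 = hyp_pi f (theta q v).
  rewrite mxE raddf_sum; apply: eq_bigr => l _.
  by rewrite !mxE /= rmorphM rmorphXn.
split.
- exact: res_complex_homog.
- by move=> a; rewrite /gdeg /= mxE; exists 1; [apply: dhomog1 | rewrite hyp_pi1].
- move=> g; exists (const_mx g); exists (fun=> 0).
  rewrite mxE big_ord1 !mxE mulr1 subrr big1 // => l _; exact: mul0r.
- move=> v /=; rewrite mxE big_ord1 [const_mx _ _ _]mxE mulr1; split.
    case=> a ea; exists (\row_l a l); apply/rowP => j; rewrite [j]ord1 ea !mxE.
    by apply: eq_bigr => l _; rewrite !mxE.
  case=> w ->; exists (fun l => w 0 l); rewrite mxE; apply: eq_bigr => l _.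
  by rewrite mxE.
case=> [|[|i]] v /=.
- have vE : v *m res_dif 0 = 0 <-> syzygy r f (lift_row v).
    rewrite -{1}(lift_rowK v) /syzygy -hyp_pi_eq0 -theta_pi.
    split=> [->|h]; first by rewrite mxE.
    by apply/rowP => j; rewrite [j]ord1 h mxE.
  split=> [/vE/G_span[t ht]|[w ->]].
    exists (map_mx (@hyp_pi k f) t); rewrite -{1}(lift_rowK v) -map_mxM.
    by apply/eqP; rewrite -subr_eq0 -map_mxB; apply/eqP/map_hyp_pi_eq0.
  rewrite -(lift_rowK w) -map_mxM; apply/rowP => j; rewrite [j]ord1 theta_pi mxE.
  apply/hyp_pi_eq0/G_span; exists (lift_row w); rewrite subrr => l.
  by rewrite mxE; apply: modf0.
- split=> [|[w ->]].
    rewrite -{1}(lift_rowK v) -map_mxM => /map_hyp_pi_eq0/G_ker[w ew].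
    by exists (map_mx (@hyp_pi k f) w); rewrite -{1}(lift_rowK v) ew map_mxM.
  rewrite -(lift_rowK w) -!map_mxM; apply/map_hyp_pi_eq0/G_ker.
  by exists (lift_row w).
by case: (odd i) => /=; apply: matrix_factorization_exact.
Qed.

Lemma res_complex_betti i j : f \is d.-homog -> (2 <= i)%N ->
  betti_frobenius_power f q i j = \rank (strand k res_complex i j).
Proof.
move=> hf i2; have d0 : (0 < d)%N by lia.
rewrite (betti_frobenius_power_resolution d0 hf _ _ res_complex_resolution).
apply: (minimal_homology_dim d0 hf) => //.
  exact: res_complex_homog.
exact: res_complex_minimal.
Qed.

End Resolution.

(** * General forms *)

Lemma conic_homog (k : fieldType) : conic k \is 2.-homog.
Proof. by rewrite rpredB // dhomogX /= mdeg3 !mnm3E. Qed.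

Lemma conicX_coef (k : fieldType) e : (conic k ^+ e)@_(mnm3 0 0 e.*2) = (-1) ^+ e.
Proof.
elim: e => [|e IH]; first by rewrite !expr0 mcoeff1 -mdeg_eq0 mdeg3 !mnm3E.
rewrite exprS mulrBl mcoeffB !mcoeffXM !lem3 !mnm3E /= sub0r exprS mulN1r -IH.
congr (- _@__); apply/mnmP; apply: ord3P; rewrite mnmBE !mnm3E //; lia.
Qed.

Local Notation form := Defs.form.

(** * The generic form and its coefficients *)

Section UniversalForm.
Variables (k : fieldType) (d : nat).
Local Notation n := #|form_monomials d|.

Definition universal_coef (m : 'X_{1..3}) : {mpoly k[n]} :=
  \sum_(i < n) 'X_i *+ (bmnm (enum_val i) == m).

Lemma universal_coef_eval c m : (universal_coef m).@[c] = (form c)@_m.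
Proof.
rewrite /form !raddf_sum; apply: eq_bigr => i _ /=.
by rewrite raddfMn /= mevalXU mcoeffZ mcoeffX mulr_natr.
Qed.

Lemma universal_det_eval q N c :
  (\det (mul_mx q N universal_coef)).@[c] = \det (mul_mx q N (fun m => (form c)@_m)).
Proof.
rewrite -det_map_mx; congr (\det _); apply/matrixP => i j; rewrite !mxE.
by case: ifP => _; rewrite ?raddf0 //= universal_coef_eval.
Qed.

Lemma form_homog (c : 'I_n -> k) : form c \is d.-homog.
Proof.
apply: rpred_sum => i _; rewrite rpredZ // dhomogX /=.
by have := enum_valP i; rewrite inE.
Qed.

Lemma form_surj (g : {mpoly k[3]}) : g \is d.-homog ->
  form (fun i : 'I_n => g@_(enum_val i)) = g.
Proof.
move=> hg; apply/mpolyP => m.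
have [dm|dm] := eqVneq (mdeg m) d; last first.
  by rewrite (dhomog_nemf_coeff (form_homog _)) // (dhomog_nemf_coeff hg).
have lt : (mdeg m < d.+1)%N by rewrite dm.
have mS : BMultinom lt \in form_monomials d by rewrite inE /= dm.
pose i := enum_rank_in mS (BMultinom lt).
have ei : enum_val i = BMultinom lt by rewrite enum_rankK_in.
rewrite /form raddf_sum (bigD1 i) //= big1 ?addr0 => [|j ji].
  by rewrite mcoeffZ mcoeffX ei eqxx mulr1.
rewrite mcoeffZ mcoeffX; case: eqP => [e|]; last by rewrite mulr0.
by case/eqP: ji; apply: enum_val_inj; rewrite ei; apply: val_inj.
Qed.

End UniversalForm.

Lemma conic_power_det (k : fieldType) p t r e : p \in [pchar k] ->
  (p ^ t = r.*2.+1)%N -> (0 < t)%N -> (e.*2 < p)%N -> (e < r)%N ->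
  \det (mul_mx r.*2.+1 (3 * r - e) (fun m => (conic k ^+ e)@_m)) != 0.
Proof.
move=> pk eq t0 ep er; apply: (@mul_mx_det _ _ _ (3 * r + e)) => //; first by lia.
by move=> g hg rg fg; apply: (conic_power_inj pk eq t0 ep er hg rg).
Qed.

Lemma odd_power_half p q : odd p -> (exists t, q = (p ^ t)%N) -> (1 < q)%N ->
  exists t, (p ^ t = q./2.*2.+1)%N /\ (0 < t)%N.
Proof.
move=> po [t ->]; case: t => [|t] // _; exists t.+1; split=> //.
by rewrite -[LHS]odd_double_half oddX po orbT.
Qed.

(** From F_2 on, the two resolutions have equal ranks, and their generator degrees differ by 3(r1 -
    r0). *)
Lemma betti_shift (k : fieldType) e r0 r1 (f : {mpoly k[3]}) i j :
  (0 < e)%N -> (e < r0)%N -> (r0 <= r1)%N ->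
  f \is e.*2.-homog -> f@_(mnm3 0 0 e.*2) != 0 ->
  \det (mul_mx r0.*2.+1 (3 * r0 - e) (fun m => f@_m)) != 0 ->
  \det (mul_mx r1.*2.+1 (3 * r1 - e) (fun m => f@_m)) != 0 -> (2 <= i)%N ->
  betti_frobenius_power f r0.*2.+1 i j =
  betti_frobenius_power f r1.*2.+1 i (j + (3 * (r1 - r0))%N%:Z).
Proof.
move=> e0 er0 r01 hf fz det0 det1 i2.
have f0 : f != 0 by apply: contraNneq fz => ->; rewrite mcoeff0.
have er1 : (e < r1)%N by apply: leq_trans r01.
have [G [phi [psi [hG [hphi hpsi] spanG kerG [e1 e2]]]]] :=
  syzygy_presentation e0 er0 hf fz det0.
have [G' [phi' [psi' [hG' [hphi' hpsi'] spanG' kerG' [e1' e2']]]]] :=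
  syzygy_presentation e0 er1 hf fz det1.
rewrite (res_complex_betti e0 er0 f0 hG hphi hpsi spanG kerG e1 e2) //.
rewrite (res_complex_betti e0 er1 f0 hG' hphi' hpsi' spanG' kerG' e1' e2') //.
congr (\rank _); rewrite /strand; congr diag_mx; apply/rowP => l; rewrite !mxE.
congr (_%:R); congr nat_of_bool; rewrite /gdeg /=.
by case: i i2 {l} => [|[|i]] // _; apply/eqP/eqP => /=; lia.
Qed.

Theorem corollary5p14 (k : fieldType) (p : nat) (hp : p \in [pchar k])
    (hp_odd : odd p) (d : nat) (hd_even : ~~ odd d) (hd2 : (2 <= d)%N)
    (hdp : (d < p + 1)%N) (q0 q1 : nat)
    (hq0 : exists e, q0 = (p ^ e)%N) (hq1 : exists e, q1 = (p ^ e)%N)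
    (hq01 : (q0 < q1)%N) (hdq0 : (d + 3 <= q0)%N) :
  for_general_form d (fun f : mpoly.mpoly 3 k =>
    forall (i : nat) (j : int), (2 <= i)%N ->
      betti_frobenius_power f q0 i j =
      betti_frobenius_power f q1 i (j + (3 * ((q1 - q0) %/ 2))%N%:Z)).
Proof.
have [t0 [e0 t0_gt0]] : exists t, (p ^ t = q0./2.*2.+1)%N /\ (0 < t)%N.
  by apply: odd_power_half => //; lia.
have [t1 [e1 t1_gt0]] : exists t, (p ^ t = q1./2.*2.+1)%N /\ (0 < t)%N.
  by apply: odd_power_half => //; lia.
have oq0 : q0 = q0./2.*2.+1.
  by case: hq0 => t ->; rewrite -[LHS]odd_double_half oddX hp_odd orbT.
have oq1 : q1 = q1./2.*2.+1.
  by case: hq1 => t ->; rewrite -[LHS]odd_double_half oddX hp_odd orbT.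
set r0 := q0./2 in e0 oq0; set r1 := q1./2 in e1 oq1.
have ed : d = d./2.*2 by rewrite -[LHS]odd_double_half (negPf hd_even).
set e := d./2 in ed.
(* Parity excludes d = p, so d < p + 1 gives 2e < p; and d + 3 <= q0 gives e < r0. *)
have [e_gt0 [er0 [er1 ep]]] : [/\ 0 < e, e < r0, e < r1 & e.*2 < p]%N.
  by split; lia.
(* The open set is where [D] does not vanish: [f] is monic in z up to a unit, and multiplication by
   [f] is bijective in the middle degrees for both powers. *)
pose D : {mpoly k[#|form_monomials d|]} := universal_coef k d (mnm3 0 0 d) *
  \det (mul_mx q0 (3 * r0 - e) (universal_coef k d)) *
  \det (mul_mx q1 (3 * r1 - e) (universal_coef k d)).
have DE c : D.@[c] = (form c)@_(mnm3 0 0 d) *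
    \det (mul_mx q0 (3 * r0 - e) (fun m => (form c)@_m)) *
    \det (mul_mx q1 (3 * r1 - e) (fun m => (form c)@_m)).
  by rewrite !mevalM universal_coef_eval !universal_det_eval.
exists (fun c => D.@[c] != 0); split.
- by exists (eq D) => c; split=> [?|[g <-]] //; exists D.
- have hf : conic k ^+ e \is d.-homog.
    by rewrite ed -muln2 mulnC; apply: dhomogMn; apply: conic_homog.
  (* The open set contains the coefficients of (xy - z^2)^e. *)
  exists (fun i : 'I_#|form_monomials d| => (conic k ^+ e)@_(enum_val i)).
  have fz : (conic k ^+ e)@_(mnm3 0 0 d) != 0.
    by rewrite ed conicX_coef expf_neq0 // oppr_eq0 oner_eq0.
  rewrite DE form_surj //; split; last by apply: contraNneq fz => ->; rewrite mcoeff0.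
  rewrite !mulf_neq0 // ?oq0 ?oq1; first exact: conic_power_det e0 _ _ _.
  exact: conic_power_det e1 _ _ _.
move=> c; rewrite DE !mulf_eq0 !negb_or => /andP[/andP[fz det0] det1] _ i j i2.
move: (form c) (form_homog c) fz det0 det1 => f hf fz det0 det1; rewrite ed in hf fz.
(* The powers are odd, so the division is exact. *)
have -> : ((q1 - q0) %/ 2 = r1 - r0)%N by lia.
rewrite oq0 oq1 in det0 det1 *; apply: (@betti_shift k e) => //; lia.
Qed.
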